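(* Let $d\ge3$ and consider the $d$-dimensional integer lattice $\mathcal{V}=\{1,\dots,m\}^d$ seen as a torus. Let $\mathcal{C}$ denote the class of all self-avoiding paths of length $k\le m$ (i.e. with $k$ nodes) in $\mathcal{V}$ (with arbitrary, unknown starting location). Assume that the autocorrelation coefficient $\psi\in(-1,1)$ is fixed and that $k=k(m)$ satisfies $k/\log m\ge C_0$ for some constant $C_0>0$. There exist constants $0<C_1\le C_2<1$ depending only on $d$ and $C_0$ such that, when $|\psi|<C_1$, \[ \lim_{m\to\infty}R^*_{\mathcal{C},\psi}=1, \] while, when $|\psi|>C_2$, \[ \lim_{m\to\infty}R^*_{\mathcal{C},\psi}=0. \]
   Context: The lattice seen as a torus is the graph with node set $\mathcal{V}=\{1,\dots,m\}^d$, identified with $(\mathbb{Z}/m\mathbb{Z})^d$, in which two nodes are adjacent if they differ by $\pm1$ (modulo $m$) in exactly one coordinate and agree in the others. A self-avoiding path in a graph with node set $\mathcal{V}$ and edge set $\mathcal{E}$ is a finite sequence of nodes $S=(s_1,\dots,s_k)\in\mathcal{V}^k$ with $(s_j,s_{j+1})\in\mathcal{E}$ for all $j$ and $s_j\neq s_{j'}$ for $j\neq j'$. A path is also identified with its set of nodes. One observes $X=(X_i)_{i\in\mathcal{V}}$ with standard normal components. Under $\mathbb{P}_0$ (the null hypothesis) the components of $X$ are independent. For $S=(s_1,\dots,s_k)\in\mathcal{C}$ and $\psi\in(-1,1)$, under $\mathbb{P}_{S,\psi}$ the vector $(X_i)_{i\in S}$ is a stationary autoregressive process of order 1 with coefficient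 $\psi$, i.e. it is a centered Gaussian vector with $\mathrm{Cov}(X_{s_i},X_{s_j})=\psi^{|i-j|}$; the components $(X_i)_{i\notin S}$ are i.i.d. standard normal; and $(X_i)_{i\in S}$ and $(X_i)_{i\notin S}$ are independent. A test is a measurable function $f:\mathbb{R}^{\mathcal{V}}\to\{0,1\}$ (which may depend on $\psi$). The worst-case risk of $f$ and the minimax risk are \[ R_{\mathcal{C},\psi}(f)=\mathbb{P}_0\{f(X)=1\}+\max_{S\in\mathcal{C}}\mathbb{P}_{S,\psi}\{f(X)=0\},\qquad R^*_{\mathcal{C},\psi}=\inf_fR_{\mathcal{C},\psi}(f), \] where the infimum is over all tests $f$. *)

(* Defs.v *)
From HB Require Import structures.
From mathcomp Require Import all_boot all_order all_algebra.
From mathcomp Require Import all_classical all_reals all_analysis.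

Set Implicit Arguments.
Unset Strict Implicit.
Unset Printing Implicit Defensive.

Import Order.TTheory GRing.Theory Num.Theory.
Import numFieldNormedType.Exports.

Local Open Scope classical_set_scope.
Local Open Scope ring_scope.
Local Open Scope ereal_scope.

Section tuple_lebesgue_step.
Context (R : realType) (n : nat).

Definition cons_pair (p : measurableTypeR R * n.-tuple R) : n.+1.-tuple R :=
  [tuple of p.1 :: p.2].

Lemma measurable_cons_pair : measurable_fun setT cons_pair.
Proof.
apply: (@measurable_cons _ _ _ R fst n snd).
- exact: measurable_fst.
- exact: measurable_snd.
Qed.

Variable mu : {sigma_finite_measure set (n.-tuple R) -> \bar R}.

Definition tuple_lebesgue_step :=
  pushforward (@lebesgue_measure R \x mu) cons_pair.

Let step0 : tuple_lebesgue_step set0 = 0.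
Proof. by rewrite /tuple_lebesgue_step /pushforward preimage_set0 measure0. Qed.

Let step_ge0 A : 0 <= tuple_lebesgue_step A.
Proof. by apply: integral_ge0 => x _; exact: measure_ge0. Qed.

Let step_sigma_additive : semi_sigma_additive tuple_lebesgue_step.
Proof.
by apply: measure_semi_sigma_additive; exact: measurable_cons_pair.
Qed.

HB.instance Definition _ := isMeasure.Build _ _ _ tuple_lebesgue_step
  step0 step_ge0 step_sigma_additive.

Let step_sigma_finite : sigma_finite setT tuple_lebesgue_step.
Proof.
have /sigma_finiteP[F [FT ndF Foo]] := sigma_finiteT (@lebesgue_measure R).
have /sigma_finiteP[G [GT ndG Goo]] := sigma_finiteT mu.
pose C i := [set t : n.+1.-tuple R | F i (thead t)] `&`
            [set t : n.+1.-tuple R | G i [tuple of behead t]].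
exists C; first (apply/esym/seteqP; split=> // t _).
  have [i _ Fi] : (\bigcup_i F i) (thead t) by rewrite -FT.
  have [j _ Gj] : (\bigcup_j G j) [tuple of behead t] by rewrite -GT.
  exists (maxn i j) => //; split.
  - by move/subsetPset: (ndF _ _ (leq_maxl i j)); apply.
  - by move/subsetPset: (ndG _ _ (leq_maxr i j)); apply.
move=> i; have [mF Fio] := Foo i; have [mG Gio] := Goo i; split.
- apply: measurableI.
  + rewrite -[X in measurable X]setTI.
    exact: (@measurable_tnth _ R _ ord0 measurableT _ mF).
  + rewrite -[X in measurable X]setTI.
    exact: (@measurable_behead _ R n measurableT _ mG).
- rewrite /tuple_lebesgue_step /pushforward.
  rewrite (_ : _ @^-1` _ = F i `*` G i).
    by rewrite product_measure1E// lte_mul_pinfty// ge0_fin_numE.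
  have bK (a : R) (t : n.-tuple R) : [tuple of behead [tuple of a :: t]] = t.
    exact/val_inj.
  apply/seteqP; split=> -[x t] /=; rewrite /C /= theadE.
    by rewrite bK.
  by rewrite bK.
Qed.

HB.instance Definition _ :=
  Measure_isSigmaFinite.Build _ _ _ tuple_lebesgue_step
    step_sigma_finite.

End tuple_lebesgue_step.

(* The n-fold product of [lebesgue_measure], i.e. Lebesgue measure on R^n; see
   [tuple_lebesgue_box]. *)
Fixpoint tuple_lebesgue (R : realType) (n : nat) :
    {sigma_finite_measure set (n.-tuple R) -> \bar R} :=
  match n with
  | 0 => \d_ [tuple]
  | n'.+1 => tuple_lebesgue_step (tuple_lebesgue R n')
  end.

Lemma tuple_lebesgue_box (R : realType) (n : nat) (A : 'I_n -> set R) :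
  (forall i, measurable (A i)) ->
  tuple_lebesgue R n [set t | forall i, A i (tnth t i)] =
    \prod_(i < n) lebesgue_measure (A i).
Proof.
elim: n A => [|n IH] A mA.
  by rewrite big_ord0 /= diracE mem_set// => -[].
rewrite big_ord_recl -IH//= /tuple_lebesgue_step /pushforward.
rewrite (_ : _ @^-1` _ =
  A ord0 `*` [set t : n.-tuple R | forall i, A (lift ord0 i) (tnth t i)]).
  rewrite product_measure1E//; first exact: mA.
  rewrite (_ : mkset _ = \big[setI/setT]_(i < n)
    ((fun t : n.-tuple R => tnth t i) @^-1` A (lift ord0 i))).
    apply: bigsetI_measurable => i _; rewrite -[X in measurable X]setTI.
    exact: measurable_tnth.
  apply/seteqP; split=> t /=.
    by move=> At; rewrite -bigcap_seq => i _; exact: At.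
  by rewrite -bigcap_seq => At i; apply: At; rewrite /= mem_index_enum.
apply/seteqP; split=> -[x t] /=.
  move=> At; split; first exact: (At ord0).
  by move=> i; have := At (lift ord0 i); rewrite tnthS.
move=> [Ax At] i; case: (unliftP ord0 i) => [j|] ->; last by [].
by rewrite tnthS.
Qed.

Definition density_law (R : realType) (n : nat) (f : n.-tuple R -> R)
    (A : set (n.-tuple R)) : \bar R :=
  \int[tuple_lebesgue R n]_(x in A) (f x)%:E.

(* density of N(0, G), for G invertible *)
Definition gaussian_pdf (R : realType) (n : nat) (G : 'M[R]_n) (y : 'rV[R]_n)
    : R :=
  (expR (- ((y *m invmx G *m y^T) 0 0) / 2) /
     Num.sqrt ((2 * pi) ^+ n * \det G))%R.

Definition ar_cov (R : realType) (psi : R) (k : nat) : 'M[R]_k :=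
  \matrix_(a < k, b < k) (psi ^+ `|a - b|%N)%R.

Section detection.
Context (R : realType) (V : finType).

(* R^V, the coordinates being listed in the order of [enum V] *)
Definition obs := #|V|.-tuple R.

Definition obs_at (x : obs) (v : V) : R := tnth x (enum_rank v).

Definition null_pdf (x : obs) : R := (\prod_v normal_pdf 0 1 (obs_at x v))%R.

(* The product form of the density expresses that the coordinates on S and
   those off S are independent, and that the latter are i.i.d. N(0, 1). *)
Definition path_pdf (k : nat) (psi : R) (S : k.-tuple V) (x : obs) : R :=
  (gaussian_pdf (ar_cov psi k) (\row_(a < k) obs_at x (tnth S a)) *
     \prod_(v | v \notin S) normal_pdf 0 1 (obs_at x v))%R.

Definition worst_case_risk (k : nat) (C : pred (k.-tuple V)) (psi : R)
    (f : obs -> bool) : \bar R :=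
  density_law null_pdf (f @^-1` [set true]) +
  \big[maxe/0]_(S : k.-tuple V | C S)
    density_law (path_pdf psi S) (f @^-1` [set false]).

Definition minimax_risk (k : nat) (C : pred (k.-tuple V)) (psi : R) : \bar R :=
  ereal_inf [set worst_case_risk C psi f | f in
    [set f : obs -> bool | measurable_fun setT f]].

End detection.

Definition torus (m d : nat) : finType := {ffun 'I_d -> 'I_m}.

(* [ordS] is the successor modulo m *)
Definition torus_adj (m d : nat) (u v : torus m d) : bool :=
  [exists i, ((v i == ordS (u i)) || (u i == ordS (v i))) &&
    [forall j, (j != i) ==> (u j == v j)]].

Definition self_avoiding_path (V : finType) (e : rel V) (k : nat) :
    pred (k.-tuple V) :=
  fun S => sorted e S && uniq S.

(* Main.v *)
Require Import Defs.
From mathcomp Require Import all_boot all_order all_algebra.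
From mathcomp Require Import all_classical all_reals all_analysis.
From mathcomp Require Import measurable_realfun zify ring lra.

(* Small correlation: by the second moment method, it suffices to find a law on
   self-avoiding paths such that E_0 [L^2] -> 1 for the averaged likelihood ratio
   L.  For two paths S and S', E_0 [L_S L_S'] reduces, by integrating out the
   nodes which are not shared (Chapman-Kolmogorov for the autoregressive kernel),
   to chains on the common nodes; by AM-GM and a Lyapunov function exp (b x^2 / 2)
   it is at most M to the number of common nodes, with M close to 1 when psi is
   small.  A simple random walk on oriented steps is too predictable when d = 3,
   so a multiscale law is used: half of the times are devoted to scale 0, a
   quarter to scale 1, etc., and at scale j a coin with 16 values directs a whole
   block of 8 * 4^j slots, i.e. 16 * 8^j units of time, and contributes 4^j (a, b),
   with 0 <= a, b < 4, to the displacement.  By uniqueness of base 4 expansions, the position after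
   32 * 8^J more steps takes any given value with conditional probability at most
   16^-(J+1).  These bounds are summable over the delays, hence the number of
   intersections has a bounded exponential moment, and the uniform starting point
   makes intersections rare.

   Large correlation: the scan test compares max_S L_S with a threshold t.  Its
   risk is at most #|C| / t + sqrt t * max_S E_0 [sqrt L_S], where
   E_0 [sqrt L_S] decays like (2 sqrt (1 - psi^2))^(k/2) and
   #|C| <= m^d (2 d)^(k-1) is exponential in k since k >= C0 ln m. *)

Set Implicit Arguments.
Unset Strict Implicit.
Unset Printing Implicit Defensive.

Import Order.TTheory GRing.Theory Num.Theory.
Import numFieldNormedType.Exports.

Local Open Scope ring_scope.

(** * Hitting times and unpredictable oriented paths *)

Section hitting.
Context (R : realFieldType) (Om : finType) (h : nat -> Om -> bool) (l : R).
Hypothesis l0 : 0 <= l.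

Let W n w : R := (h n w)%:R * \prod_(0 <= i < n) (1 + l * (h i w)%:R).

Let W_ge0 n w : 0 <= W n w.
Proof.
by rewrite mulr_ge0// prodr_ge0// => i _; rewrite addr_ge0// mulr_ge0.
Qed.

(** Expands the product according to the last index whose factor contributes [l]; [W i] gathers the
    terms for which that index is [i]. *)
Let prodE n w : \prod_(0 <= i < n) (1 + l * (h i w)%:R) = 1 + l * \sum_(0 <= i < n) W i w.
Proof.
elim: n => [|n IH]; first by rewrite !big_geq// mulr0 addr0.
rewrite big_nat_recr//= [in RHS]big_nat_recr//= /W IH.
by set s := \sum_(_ <= _ < _) _; ring.
Qed.

(* A Khas'minskii-type bound: [q] bounds the conditional probabilities of hitting
   again, given the hitting history, after a delay [n - i]. *)
Lemma sum_prod_hits_le (q : nat -> R) (A : R) (k : nat) :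
  (forall n i (F : Om -> R), (i < n < k)%N -> (forall w, 0 <= F w) ->
    (forall w w', (forall j, (j <= i)%N -> h j w = h j w') -> F w = F w') ->
    \sum_w (h n w)%:R * F w <= q (n - i)%N * \sum_w F w) ->
  (forall j, 0 <= q j) -> \sum_(1 <= j < k) q j <= A -> l * A < 1 ->
  \sum_w \prod_(0 <= i < k) (1 + l * (h i w)%:R) <=
  #|Om|%:R + l / (1 - l * A) * \sum_w \sum_(0 <= n < k) (h n w)%:R.
Proof.
move=> hq q0 qA lA.
pose S n := \sum_w W n w.
have S0 n : 0 <= S n by apply: sumr_ge0.
(* The predictability hypothesis, applied to [F = W i], bounds the sum of the [S n] by the total
   number of hits plus [l * A] times itself. As [l * A < 1], this is then solved for the sum. *)
have SE : \sum_(0 <= n < k) S n <=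
    \sum_w \sum_(0 <= n < k) (h n w)%:R + l * A * \sum_(0 <= n < k) S n.
  have step n : (n < k)%N ->
      S n <= \sum_w (h n w)%:R + l * \sum_(0 <= i < n) q (n - i)%N * S i.
    move=> nk; rewrite /S; under eq_bigr do rewrite /W prodE mulrDr mulr1 mulrCA mulr_sumr.
    rewrite big_split/= lerD2l -mulr_sumr ler_wpM2l// exchange_big/=.
    rewrite big_nat_cond [leRHS]big_nat_cond; apply: ler_sum => i.
    rewrite andbT => /andP[_ ik]; apply: hq; [by rewrite ik|by move=> w; exact: W_ge0|].
    move=> w w' hww'; rewrite /W hww'//; congr (_ * _).
    rewrite big_nat_cond [RHS]big_nat_cond; apply: eq_bigr => j.
    by rewrite andbT => /andP[_ ji]; rewrite hww'// ltnW.
  apply: (@le_trans _ _ (\sum_(0 <= n < k) (\sum_w (h n w)%:R +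
     l * \sum_(0 <= i < n) q (n - i)%N * S i))).
    by rewrite big_nat_cond [leRHS]big_nat_cond; apply: ler_sum => n;
       rewrite andbT => /andP[_]; exact: step.
  rewrite big_split/= exchange_big/= lerD2l -mulr_sumr -mulrA ler_wpM2l//.
  rewrite mulr_sumr (eq_big_nat _ _ (F2 := fun n =>
    \sum_(0 <= i < k | (i < n)%N) q (n - i)%N * S i)); last first.
    by move=> n /andP[_ nk]; rewrite (big_nat_widen _ _ k)// ltnW.
  rewrite (exchange_big_dep_nat xpredT)//=.
  rewrite big_nat_cond [leRHS]big_nat_cond; apply: ler_sum => i.
  rewrite andbT => /andP[_ ik]; rewrite -mulr_suml ler_wpM2r//.
  have -> : \sum_(0 <= n < k | (i < n)%N) q (n - i)%N = \sum_(i.+1 <= n < k) q (n - i)%N.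
    by rewrite [RHS](big_nat_widenl _ 0).
  rewrite -{1}[i.+1]add1n big_addn.
  under eq_bigr do rewrite addnK.
  apply: le_trans qA; rewrite [leRHS](@big_cat_nat _ _ _ (k - i))//=; last 2 first.
  - by rewrite subn_gt0.
  - exact: leq_subr.
  by rewrite lerDl sumr_ge0.
have lA' : 0 < 1 - l * A by rewrite subr_gt0.
have SS : \sum_(0 <= n < k) S n <=
    (\sum_w \sum_(0 <= n < k) (h n w)%:R) / (1 - l * A).
  rewrite ler_pdivlMr// mulrBr mulr1 lerBlDr (le_trans SE)//.
  by rewrite lerD2l mulrC.
under eq_bigr do rewrite prodE.
rewrite big_split/= sumr_const lerD// -mulr_sumr exchange_big/=.
by rewrite -mulrA ler_wpM2l// mulrC.
Qed.

End hitting.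

(** * Multiscale walks on the integers and base 4 digits *)

Section scales.
Implicit Types (i j n b : nat).
Local Open Scope nat_scope.

(* Time [n] is devoted to scale [j = logn 2 n.+1]; [slots j n] is the number of
   times before [n] devoted to scale [j]. *)
Definition slots j n := (n + 2 ^ j) %/ 2 ^ j.+1.

Lemma divnS_dvd a d : 0 < d -> a.+1 %/ d = a %/ d + (d %| a.+1).
Proof.
move=> d0; have := divn_eq a d; have := ltn_pmod a d0.
set q := a %/ d; set r := a %% d => rd ->.
have [rd1|rd1] := eqVneq r.+1 d.
  have -> : (q * d + r).+1 = q.+1 * d by rewrite mulSn -rd1 addnC addSn addnC.
  by rewrite mulnK// dvdn_mull// addn1.
have {}rd1 : r.+1 < d by rewrite ltn_neqAle rd1.
rewrite -addnS divnMDl// divn_small// addn0.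
by rewrite /dvdn modnMDl modn_small// addn0.
Qed.

(** [slots j n] counts the odd multiples of [2 ^ j] among [1, ..., n], and these are the integers of
    2-adic valuation [j]. *)
Lemma slotsS j n : slots j n.+1 = slots j n + (j == logn 2 n.+1).
Proof.
rewrite /slots addSn divnS_dvd ?expn_gt0//; congr (_ + _).
rewrite -addSn; congr nat_of_bool.
have p2 : prime 2 by [].
apply/idP/eqP => [H|->]; last first.
  have := pfactor_dvdnn 2 n.+1; set l := logn 2 n.+1 => /dvdnP[q e].
  have oq : odd q.
    have : ~~ (2 ^ l.+1 %| n.+1) by rewrite pfactor_dvdn// ltnn.
    rewrite e expnS dvdn_pmul2r ?expn_gt0//.
    by rewrite dvdn2 negbK.
  rewrite e expnS -mulSnr dvdn_pmul2r ?expn_gt0//.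
  by rewrite dvdn2 /= oq.
have j1 : 2 ^ j %| n.+1.
  rewrite -(dvdn_addl (n := 2 ^ j))//.
  by apply: dvdn_trans H; rewrite dvdn_exp2l.
apply/eqP; rewrite eqn_leq -pfactor_dvdn// j1 leqNgt -pfactor_dvdn//=.
apply/negP => H'; move: H; rewrite (dvdn_addr _ H').
by rewrite dvdn_Pexp2l// ltnn.
Qed.

Lemma leq_slots j n n' : n <= n' -> slots j n <= slots j n'.
Proof. by move=> nn; rewrite /slots leq_div2r// leq_add2r. Qed.

Lemma slots_addM j n q : slots j (n + q * 2 ^ j.+1) = slots j n + q.
Proof. by rewrite /slots addnAC addnC divnMDl ?expn_gt0// addnC. Qed.

Lemma slots_leq j n : slots j n <= n.
Proof.
rewrite /slots -ltnS ltn_divLR ?expn_gt0// expnS.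
have : 0 < 2 ^ j by rewrite expn_gt0.
nia.
Qed.

Lemma slots0 j : slots j 0 = 0.
Proof. by rewrite /slots divn_small// ltn_exp2l. Qed.

Definition coin := ('I_4 * 'I_4)%type.

(* Over eight consecutive slots the coin [c] prescribes [c.1] moves along the
   first axis and [c.2] along the second one; the others are along the third. *)
Definition xstep (c : coin) i : nat := i %% 8 < c.1.
Definition ystep (c : coin) i : nat := 4 <= i %% 8 < 4 + c.2.

Lemma xystep_le1 (c : coin) i : xstep c i + ystep c i <= 1.
Proof.
rewrite /xstep /ystep; have c4 : c.1 < 4 := ltn_ord _.
have [ic|_] := ltnP (i %% 8) c.1; last by case: (_ && _).
by rewrite (leqNgt 4) (ltn_trans ic c4).
Qed.

Definition block_len j := 8 * 4 ^ j.

(** Scales are truncated at [J]; by [walkS] the recursion is exact as long as [J] exceeds the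
    valuations of the times considered. *)
Definition walk (step : coin -> nat -> nat) (J : nat) (w : nat -> nat -> coin) n :=
  \sum_(0 <= j < J) \sum_(0 <= i < slots j n) step (w j (i %/ block_len j)) i.

Lemma walkS step J w n : logn 2 n.+1 < J ->
  walk step J w n.+1 = walk step J w n +
   (let j := logn 2 n.+1 in step (w j (slots j n %/ block_len j)) (slots j n)).
Proof.
set l := logn 2 n.+1 => lJ /=; rewrite /walk !big_mkord.
rewrite (bigD1 (Ordinal lJ))//= [in RHS](bigD1 (Ordinal lJ))//= addnAC.
congr (_ + _).
  by rewrite slotsS eqxx addn1 big_nat_recr.
by apply: eq_bigr => j jl; rewrite slotsS -/l (_ : val j == l = false) ?addn0//;
  apply/negbTE.
Qed.

Lemma walk0 step J w : walk step J w 0 = 0.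
Proof. by apply: big1 => j _; rewrite slots0 big_geq. Qed.

Lemma logn2_lt n m : n.+1 < m -> logn 2 n.+1 < m.
Proof.
by move=> nm; apply: leq_ltn_trans nm; rewrite ltnW// ltn_logl.
Qed.

(** At most one of the two walks moves at each time. This makes the truncated subtraction in [shift]
    exact. *)
Lemma walk_xy_le m w n : n < m -> walk xstep m w n + walk ystep m w n <= n.
Proof.
elim: n => [|n IH] nm; first by rewrite !walk0.
rewrite !walkS ?logn2_lt//= addnACA; apply: (@leq_trans (n + 1)); last by rewrite addn1.
by apply: leq_add; [exact: IH (ltnW nm)|exact: xystep_le1].
Qed.

Lemma sum_period (f : nat -> nat) (a : nat) : (forall i, f (i + 8) = f i) ->
  \sum_(0 <= i < 8 * a) f i = a * \sum_(0 <= i < 8) f i.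
Proof.
move=> f8; have f8a b i : f (i + 8 * b) = f i.
  by elim: b => [|b IH]; rewrite ?muln0 ?addn0// mulnS addnCA addnC f8.
elim: a => [|a IH]; first by rewrite muln0 big_geq.
rewrite mulnS addnC (@big_cat_nat _ _ _ (8 * a))//=; last exact: leq_addr.
rewrite IH [in RHS]mulSn [in RHS]addnC; congr (_ + _).
rewrite -{1}[8 * a]add0n big_addn addKn.
by apply: eq_bigr => i _; rewrite f8a.
Qed.

Lemma sum_xstep (c : coin) a : \sum_(0 <= i < 8 * a) xstep c i = a * c.1.
Proof.
rewrite sum_period; last by move=> i; rewrite /xstep modnDr.
congr (_ * _); rewrite /xstep unlock /=.
by case: c => -[[|[|[|[|?]]]] ?] ?.
Qed.

Lemma sum_ystep (c : coin) a : \sum_(0 <= i < 8 * a) ystep c i = a * c.2.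
Proof.
rewrite sum_period; last by move=> i; rewrite /ystep modnDr.
congr (_ * _); rewrite /ystep unlock /=.
by case: c => ? -[[|[|[|[|?]]]] ?].
Qed.

(** Separates the coin of block [b] from all the others. The block has to be complete before slot
    [D] for its total to be exactly [4 ^ j * v (f b)]. *)
Lemma sum_block step (v : coin -> nat) (f : nat -> coin) j b D :
  (forall c a, \sum_(0 <= i < 8 * a) step c i = a * v c) ->
  b.+1 * block_len j <= D ->
  \sum_(0 <= i < D) step (f (i %/ block_len j)) i =
  4 ^ j * v (f b) +
  \sum_(0 <= i < D | i %/ block_len j != b) step (f (i %/ block_len j)) i.
Proof.
move=> stepv bD; set T := block_len j.
have T0 : 0 < T by rewrite muln_gt0 expn_gt0.
rewrite (bigID (fun i => i %/ T == b))/=; congr (_ + _).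
have bT : b * T <= b.+1 * T by rewrite leq_mul2r leqnSn orbT.
rewrite (@big_cat_nat _ _ _ (b.+1 * T))//=.
rewrite [X in _ + X]big_nat_cond [X in _ + X]big1 ?addn0; last first.
  move=> i /andP[/andP[h _] /eqP ib]; move: h; rewrite -leq_divRL// ib.
  by rewrite ltnn.
rewrite (@big_cat_nat _ _ _ (b * T))//=.
rewrite [X in X + _]big_nat_cond [X in X + _]big1 ?add0n; last first.
  move=> i /andP[/andP[_ h] /eqP ib]; move: h; rewrite -ltn_divLR// ib.
  by rewrite ltnn.
transitivity (\sum_(b * T <= i < b.+1 * T) step (f b) i).
  rewrite big_nat_cond [RHS]big_nat_cond; apply: eq_big => i.
    rewrite andbT; apply/andP/idP => [[]//|h]; split=> //.
    move: h => /andP[h1 h2]; rewrite eqn_leq leq_divRL// h1 andbT.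
    by rewrite -ltnS ltn_divLR.
  by move=> /andP[_ /eqP ->].
(* A block is the difference of two initial segments whose lengths are multiples of 8. *)
have e1 := stepv (f b) (b * 4 ^ j); have e2 := stepv (f b) (b.+1 * 4 ^ j).
move: e2; rewrite (@big_cat_nat _ _ _ (8 * (b * 4 ^ j)))//=; last first.
  by rewrite leq_mul2l/= leq_mul2r leqnSn orbT.
rewrite e1 (_ : 8 * (b * 4 ^ j) = b * T); last by rewrite /T /block_len mulnCA.
rewrite (_ : 8 * (b.+1 * 4 ^ j) = b.+1 * T); last by rewrite /T /block_len mulnCA.
by move=> /eqP; rewrite [b.+1 * 4 ^ j]mulSnr mulnDl eqn_add2l => /eqP.
Qed.

Lemma digits_lt (a : nat -> nat) J : (forall j, a j < 4) ->
  \sum_(0 <= j < J) 4 ^ j * a j < 4 ^ J.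
Proof.
move=> a4; elim: J => [|J IH]; first by rewrite big_geq.
by rewrite big_nat_recr//= expnS; have := a4 J; nia.
Qed.

(** The lower digits sum to less than [4 ^ J], so division by [4 ^ J] isolates the top digit;
    induction does the rest. *)
Lemma digits_inj (a b : nat -> nat) J :
  (forall j, a j < 4) -> (forall j, b j < 4) ->
  \sum_(0 <= j < J) 4 ^ j * a j = \sum_(0 <= j < J) 4 ^ j * b j ->
  forall j, j < J -> a j = b j.
Proof.
move=> a4 b4; elim: J => [//|J IH]; rewrite !big_nat_recr//= => e.
have da := digits_lt J a4; have db := digits_lt J b4.
have aJ : a J = b J.
  have := congr1 (divn^~ (4 ^ J)) e; rewrite /= ![_ + 4 ^ J * _]addnC.
  by rewrite ![4 ^ J * _]mulnC !divnMDl ?expn_gt0// !divn_small// !addn0.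
move: e; rewrite aJ => /eqP; rewrite eqn_add2r => /eqP e j.
by rewrite ltnS leq_eqVlt => /predU1P[->//|]; exact: IH.
Qed.

End scales.

(** * Random oriented paths on the torus and their unpredictability *)

Section torus_walk.
Context (d m : nat).
Hypothesis (d3 : (2 < d)%N) (m0 : (0 < m)%N).
Local Open Scope nat_scope.

(* [w (j, b)] directs the [b]-th block of [block_len j] time slots of scale [j];
   indices are at most [m], so that [inord] in [coin_at] never truncates. *)
Definition coins := {ffun 'I_m.+1 * 'I_m.+1 -> coin}.
Definition coin_at (w : coins) (j b : nat) : coin := w (inord j, inord b).

(** Only three axes are used; the third takes every move that the first two leave, so that each unit
    of time makes exactly one move. *)
Definition shift (w : coins) (n : nat) (i : nat) : nat :=
  let x := walk xstep m (coin_at w) n in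
  let y := walk ystep m (coin_at w) n in
  if i is i'.+1 then if i' is i''.+1 then if i'' is _.+1 then 0 else n - x - y
    else y else x.

Definition torus_pos (u : torus m d) (w : coins) (n : nat) : torus m d :=
  [ffun i => Ordinal (ltn_pmod (u i + shift w n i) m0)].

(** An oriented path climbs one level, modulo [m], per step. With at most [m] nodes it meets each
    level at most once, which makes it self-avoiding. *)
Definition level (v : torus m d) := (\sum_i v i) %% m.

Lemma sum_shift (w : coins) n : n < m -> \sum_(i < d) shift w n i = n.
Proof.
case: d d3 => [|[|[|d']]]// _ nm.
rewrite !big_ord_recl /= big1 ?addn0; last by move=> i _.
have := walk_xy_le (coin_at w) nm; lia.
Qed.

Lemma level_torus_pos u w n : n < m ->
  level (torus_pos u w n) = (\sum_i u i + n) %% m.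
Proof.
move=> nm; rewrite /level -[in RHS](sum_shift w nm) -big_split/=.
under eq_bigr do rewrite ffunE/=.
exact: modn_summ.
Qed.

Lemma torus_pos_inj u w n n' : n < m -> n' < m ->
  torus_pos u w n = torus_pos u w n' -> n = n'.
Proof.
move=> nm nm' /(congr1 level); rewrite !level_torus_pos// => /eqP.
by rewrite eqn_modDl !modn_small// => /eqP.
Qed.

Lemma shiftS (w : coins) n : n.+1 < m ->
  exists i0 : 'I_d, forall i : 'I_d, shift w n.+1 i = shift w n i + (i == i0).
Proof.
move=> nm.
have le0 := walk_xy_le (coin_at w) (ltnW nm); have le1 := walk_xy_le (coin_at w) nm.
move: le0 le1; rewrite /shift !walkS ?logn2_lt//=.
set a := xstep _ _; set b := ystep _ _ => le0 le1.
have ab : a + b <= 1 by exact: xystep_le1.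
pose k := if a == 1 then 0 else if b == 1 then 1 else 2.
have kd : k < d.
  by apply: leq_ltn_trans d3; rewrite /k; case: ifP => // _; case: ifP.
exists (Ordinal kd) => i; rewrite -val_eqE /= /k.
by case: (val i) => [|[|[|i']]]//=; move: ab le0 le1;
  case: (a) => [|[|?]]; case: (b) => [|[|?]] //=; lia.
Qed.

Lemma torus_adj_pos u w n : n.+1 < m ->
  torus_adj (torus_pos u w n) (torus_pos u w n.+1).
Proof.
move=> nm; have [i0 hi0] := shiftS w nm.
apply/existsP; exists i0; apply/andP; split.
  apply/orP; left; apply/eqP/val_inj; rewrite !ffunE /= hi0 eqxx addn1 addnS.
  by rewrite -[in RHS]addn1 modnDml addn1.
apply/forallP => i; apply/implyP => ii0; apply/eqP/val_inj; rewrite !ffunE /=.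
by rewrite hi0 (negbTE ii0) addn0.
Qed.

Definition torus_path k u w : k.-tuple (torus m d) :=
  [tuple torus_pos u w i | i < k].

Lemma nth_torus_path k u w v i : i < k -> nth v (torus_path k u w) i = torus_pos u w i.
Proof. by move=> ik; rewrite -[i]/(val (Ordinal ik)) -tnth_nth tnth_mktuple. Qed.

Lemma mem_torus_path k u w v :
  reflect (exists2 i, i < k & v = torus_pos u w i) (v \in torus_path k u w).
Proof.
apply: (iffP (nthP v)) => -[i]; rewrite size_tuple => ik.
  by rewrite nth_torus_path// => <-; exists i.
by move=> ->; exists i; rewrite ?size_tuple// nth_torus_path.
Qed.

Lemma torus_path_uniq k u w : k <= m -> uniq (torus_path k u w).
Proof.
move=> km; apply/(uniqP (torus_pos u w 0)) => i j.
rewrite !inE !size_tuple => ik jk; rewrite !nth_torus_path//.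
by apply: torus_pos_inj; exact: leq_trans km.
Qed.

Lemma torus_path_self_avoiding k u w : k <= m ->
  self_avoiding_path (@torus_adj m d) (torus_path k u w).
Proof.
move=> km; rewrite /self_avoiding_path torus_path_uniq// andbT.
apply/(sortedP (torus_pos u w 0)) => i; rewrite size_tuple => ik.
rewrite !nth_torus_path ?torus_adj_pos//; first exact: leq_trans km.
exact: ltnW.
Qed.

Section predictability.
Variables (k : nat) (u : torus m d) (S : pred (torus m d)).
Hypothesis km : k <= m.
Hypothesis S_level : {in S &, injective level}.

Definition hit n (w : coins) := torus_pos u w n \in S.

Section fresh.
Variables (i n J : nat).
Hypotheses (nk : n < k) (Jin : 32 * 8 ^ J + i <= n).

(** The block after the one containing slot [slots j i]: none of its slots is used before time
    [i]. *)
Let beta j := (slots j i %/ block_len j).+1.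

Definition fresh (c : {ffun 'I_J.+1 -> coin}) : coins :=
  [ffun p : 'I_m.+1 * 'I_m.+1 =>
    if (p.1 <= J) && (p.2 == beta p.1 :> nat) then c (inord p.1) else 0%R].

(** A translation in the group of coin tables: for fixed [c] it permutes the tables, hence preserves
    sums over [w]. *)
Definition refresh (c : {ffun 'I_J.+1 -> coin}) (w : coins) : coins := (w + fresh c)%R.

(** Numbers with [J.+1] digits in base 4 are thus below [m], and their congruence modulo [m] is
    equality. *)
Let pow_lt : 4 ^ J.+1 <= m.
Proof.
have h : 4 ^ J <= 8 ^ J by case: (J) => // j; rewrite leq_exp2r.
rewrite expnS; move: Jin nk km h; lia.
Qed.

Let Jm : J < m.
Proof.
by apply: leq_trans pow_lt; rewrite (leq_trans (ltn_expl J (isT : 1 < 4)))// leq_exp2l.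
Qed.

Let block_pos j : 0 < block_len j.
Proof. by rewrite muln_gt0 expn_gt0. Qed.

(** The end of block [beta j] is at most two block lengths after slot [slots j i], and
    [2 * block_len j] slots of scale [j] take [2 * 8 * 4 ^ j * 2 ^ j.+1 = 32 * 8 ^ j] units of
    time. *)
Lemma fresh_done j : j <= J -> (beta j).+1 * block_len j <= slots j n.
Proof.
move=> jJ; apply: (@leq_trans (slots j (i + (2 * block_len j) * 2 ^ j.+1))).
  rewrite slots_addM /beta -addn2 mulnDl addnC [X in _ <= X]addnC leq_add2l.
  exact: leq_trunc_div.
apply: leq_slots; apply: leq_trans Jin; rewrite addnC leq_add2r.
rewrite (_ : _ * _ = 32 * 8 ^ j); first by rewrite leq_mul2l /= leq_exp2l.
rewrite /block_len expnS (_ : 8 = 4 * 2)// expnMn; nia.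
Qed.

Lemma beta_le j : j <= J -> beta j < m.+1.
Proof.
move=> /fresh_done H; have := slots_leq j n; have := block_pos j.
have : n < m by exact: leq_trans km.
nia.
Qed.

Lemma coin_refresh (c : {ffun 'I_J.+1 -> coin}) w j b : j < m -> b <= m ->
  coin_at (refresh c w) j b =
  if (j <= J) && (b == beta j) then (coin_at w j b + c (inord j))%R else coin_at w j b.
Proof.
move=> jm bm; rewrite /coin_at !ffunE /= !inordK ?ltnS//; last exact: ltnW.
by case: ifP => // _; rewrite addr0.
Qed.

Lemma torus_pos_refresh_past (c : {ffun 'I_J.+1 -> coin}) w j : j <= i ->
  torus_pos u (refresh c w) j = torus_pos u w j.
Proof.
move=> ji.
suff walkE step : walk step m (coin_at (refresh c w)) j = walk step m (coin_at w) j.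
  by apply/ffunP => e; rewrite !ffunE /shift !walkE.
rewrite /walk big_nat_cond [RHS]big_nat_cond; apply: eq_bigr => s.
rewrite andbT => /andP[_ sm].
rewrite big_nat_cond [RHS]big_nat_cond; apply: eq_bigr => e.
rewrite andbT => /andP[_ es].
have ei : e < slots s i by apply: leq_trans es _; exact: leq_slots.
rewrite coin_refresh//; last first.
  rewrite (leq_trans (leq_div _ _))// ltnW// (leq_trans ei)//.
  rewrite (leq_trans (slots_leq _ _))//; move: Jin nk km; lia.
rewrite (_ : _ == _ = false) ?andbF//; apply/negbTE; rewrite neq_ltn.
by rewrite ltnS leq_div2r// ltnW.
Qed.

(** The remainder [r] is common to all [c]: the refreshed blocks are complete at time [n], so each
    of them enters as a single term of weight [4 ^ j]. *)
Lemma walk_refresh step (v : coin -> nat) (w : coins) :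
  (forall c a, \sum_(0 <= e < 8 * a) step c e = a * v c) ->
  exists r, forall c : {ffun 'I_J.+1 -> coin},
  walk step m (coin_at (refresh c w)) n =
  r + \sum_(0 <= j < J.+1) 4 ^ j * v (coin_at w j (beta j) + c (inord j))%R.
Proof.
move=> stepv.
exists (\sum_(0 <= j < J.+1) \sum_(0 <= e < slots j n | e %/ block_len j != beta j)
           step (coin_at w j (e %/ block_len j)) e +
  \sum_(J.+1 <= j < m) \sum_(0 <= e < slots j n)
           step (coin_at w j (e %/ block_len j)) e) => c.
have em s e : e < slots s n -> e %/ block_len s <= m.
  move=> es; rewrite (leq_trans (leq_div _ _))// ltnW// (leq_trans es)//.
  by rewrite (leq_trans (slots_leq _ _))// ltnW// (leq_trans nk).
rewrite /walk (@big_cat_nat _ _ _ J.+1)//= addnAC; congr (_ + _); last first.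
  rewrite big_nat_cond [RHS]big_nat_cond; apply: eq_bigr => s.
  rewrite andbT => /andP[Js sm].
  rewrite big_nat_cond [RHS]big_nat_cond; apply: eq_bigr => e.
  rewrite andbT => /andP[_ es].
  by rewrite coin_refresh// ?em// leqNgt Js.
rewrite addnC -big_split/= big_nat_cond [RHS]big_nat_cond; apply: eq_bigr => s.
rewrite andbT => /andP[_ sJ]; rewrite ltnS in sJ.
have sm : s < m by rewrite (leq_ltn_trans sJ).
rewrite (sum_block (b := beta s) (coin_at (refresh c w) s) stepv); last exact: fresh_done.
congr (_ + _).
  by rewrite coin_refresh// ?sJ ?eqxx// -ltnS beta_le.
rewrite big_nat_cond [RHS]big_nat_cond; apply: eq_bigr => e.
move=> /andP[/andP[_ es] eb].
by rewrite coin_refresh ?em// (negbTE eb) andbF.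
Qed.

(** All positions at time [n] have the same level and [S] has at most one node per level, so two
    hits are at the same position. Its first two coordinates determine the base 4 digits, hence all
    the refreshed coins. *)
Lemma fresh_hits_le1 w : #|[set c | hit n (refresh c w)]| <= 1.
Proof.
rewrite leqNgt; apply/negP => /card_gt1P[c [c' [hc hc' /eqP cc']]]; apply: cc'.
move: hc hc'; rewrite !inE /hit => hc hc'.
have nm : n < m by exact: leq_trans km.
have e : torus_pos u (refresh c w) n = torus_pos u (refresh c' w) n.
  by apply: S_level => //; rewrite !level_torus_pos.
have [rx hx] := walk_refresh w sum_xstep.
have [ry hy] := walk_refresh w sum_ystep.
have digit (a b : coin -> 'I_4) r :
    (r + \sum_(0 <= j < J.+1) 4 ^ j * a (coin_at w j (beta j) + c (inord j))%R) %% m =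
    (r + \sum_(0 <= j < J.+1) 4 ^ j * a (coin_at w j (beta j) + c' (inord j))%R) %% m ->
    forall j, j < J.+1 -> a (coin_at w j (beta j) + c (inord j))%R =
      a (coin_at w j (beta j) + c' (inord j))%R.
  move=> /eqP; rewrite eqn_modDl !modn_small; last 2 first.
  - apply: leq_trans pow_lt.
    by apply: (digits_lt _ (a := fun j => a (coin_at w j (beta j) + c' (inord j))%R)).
  - apply: leq_trans pow_lt.
    by apply: (digits_lt _ (a := fun j => a (coin_at w j (beta j) + c (inord j))%R)).
  move=> /eqP e0 j jJ; apply: val_inj.
  by apply: (digits_inj (a := fun j => a (coin_at w j (beta j) + c (inord j))%R)
    (b := fun j => a (coin_at w j (beta j) + c' (inord j))%R) _ _ e0).
have coord (s : nat) (sd : s < d) :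
    (shift (refresh c w) n s) %% m = (shift (refresh c' w) n s) %% m.
  have := congr1 val (congr1 (fun f : torus m d => f (Ordinal sd)) e).
  by rewrite !ffunE /= => /eqP; rewrite eqn_modDl => /eqP.
have := coord 0 (leq_trans (isT : 0 < 3) d3).
have := coord 1 (leq_trans (isT : 1 < 3) d3).
rewrite /shift /= !hx !hy => /(digit snd snd) dy /(digit fst fst) dx.
apply/ffunP => j.
have jE : inord (val j) = j by exact: inord_val.
have := dx j (ltn_ord j); have := dy j (ltn_ord j); rewrite jE.
by move=> /addrI e2 /addrI e1; rewrite (surjective_pairing (c j)) e1 e2 -surjective_pairing.
Qed.

End fresh.
End predictability.
End torus_walk.

Lemma sum_pair (M : nmodType) (I J : finType) (G : I * J -> M) :
  \sum_p G p = \sum_i \sum_j G (i, j).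
Proof. by rewrite pair_bigA; apply: eq_bigr => -[]. Qed.

(** * Exponential moment of the number of common nodes of two random paths *)

Section moment.
Context (R : realFieldType) (d m : nat).
Hypothesis (d3 : (2 < d)%N) (m0 : (0 < m)%N).

(** The bound wanted at delay [g] is [16 ^- J] for the least [J] with [g < 32 * 8 ^ J]; summing over
    all such [J] only enlarges it and makes the sum over delays a plain exchange. *)
Definition hit_bound (g : nat) : R :=
  \sum_(0 <= J < m) 16%:R ^- J * (g < 32 * 8 ^ J)%:R.

Lemma hit_bound_ge0 g : 0 <= hit_bound g.
Proof. by apply: sumr_ge0 => J _; rewrite mulr_ge0// invr_ge0 exprn_ge0. Qed.

Lemma hit_bound_ge J g : (J < m)%N -> (g < 32 * 8 ^ J)%N -> 16%:R ^- J <= hit_bound g.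
Proof.
move=> Jm gJ; rewrite /hit_bound big_mkord (bigD1 (Ordinal Jm))//= gJ mulr1 lerDl.
by apply: sumr_ge0 => i _; rewrite mulr_ge0// invr_ge0 exprn_ge0.
Qed.

Lemma sum_half_le (n : nat) : \sum_(0 <= J < n) 2%:R ^- J <= 2 :> R.
Proof.
suff -> : \sum_(0 <= J < n) 2%:R ^- J = 2 - 2 * 2%:R ^- n :> R.
  by rewrite lerBlDr lerDl mulr_ge0// invr_ge0 exprn_ge0.
elim: n => [|n IH]; first by rewrite big_geq// expr0 invr1; ring.
rewrite big_nat_recr//= IH exprS invfM.
have : 2%:R * 2%:R^-1 = 1 :> R by rewrite mulfV// pnatr_eq0.
move: (2%:R ^- n) => x; lra.
Qed.

Lemma sum_lt_le (L k : nat) : (\sum_(1 <= j < k) (j < L)%N <= L)%N.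
Proof.
case: k => [|k]; first by rewrite big_geq.
rewrite big_add1/=; suff : (\sum_(0 <= j < k) (j.+1 < L)%N <= minn k L)%N.
  by rewrite leq_min => /andP[].
elim: k => [|k IH]; first by rewrite big_geq.
by rewrite big_nat_recr//=; move: IH; case: (ltnP k.+1 L); lia.
Qed.

(** Scale [J] concerns at most [32 * 8 ^ J] delays with weight [16 ^- J], so it contributes at most
    [32 * 2 ^- J]. *)
Lemma sum_hit_bound_le k : \sum_(1 <= j < k) hit_bound j <= 64%:R.
Proof.
rewrite /hit_bound exchange_big/=.
apply: (@le_trans _ _ (\sum_(0 <= J < m) 32%:R * 2%:R ^- J)); last first.
  by rewrite -mulr_sumr (le_trans (ler_wpM2l _ (sum_half_le m)))// -natrM ler_nat.
apply: ler_sum => J _; rewrite -mulr_sumr.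
have -> : 32%:R * 2%:R ^- J = 16%:R ^- J * (32 * 8 ^ J)%N%:R :> R.
  rewrite natrM natrX (_ : 16%:R = 2%:R * 8%:R :> R); last by rewrite -natrM.
  by rewrite exprMn invfM [in RHS]mulrCA -mulrA mulVf ?mulr1 ?expf_neq0 ?pnatr_eq0.
by rewrite ler_wpM2l ?invr_ge0 ?exprn_ge0// -natr_sum ler_nat sum_lt_le.
Qed.

Lemma card_coin : #|{: coin}| = 16.
Proof. by rewrite card_prod !card_ord. Qed.

Section fixed_path.
Variables (k : nat) (S : pred (torus m d)).
Hypothesis km : (k <= m)%N.
Hypothesis S_level : {in S &, injective (@level d m)}.

(* Averaging over the [16 ^ J.+1] values of the fresh coins does not change the
   past, and at most one of these values leads to a hit at time [n]. *)
Lemma hit_fresh_le u i n J (F : coins m -> R) : (n < k)%N ->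
  (32 * 8 ^ J + i <= n)%N -> (forall w, 0 <= F w) ->
  (forall w w', (forall j, (j <= i)%N -> hit m0 u S j w = hit m0 u S j w') -> F w = F w') ->
  \sum_w (hit m0 u S n w)%:R * F w <= 16%:R ^- J.+1 * \sum_w F w.
Proof.
move=> nk Jin F0 FE.
rewrite mulrC ler_pdivlMr ?exprn_gt0// mulrC.
have cardC : #|{ffun 'I_J.+1 -> coin}| = (16 ^ J.+1)%N.
  by rewrite card_ffun card_coin card_ord.
rewrite -natrX -cardC mulr_natl -sumr_const.
under eq_bigr => c _.
  rewrite (reindex_inj (addIr (fresh m i c)))/=.
  under eq_bigr => w _.
    rewrite (FE _ w); last first.
      move=> j ji; rewrite /hit -/(refresh i c w).
      by rewrite (torus_pos_refresh_past d3 m0 u km nk Jin).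
    over.
  over.
rewrite exchange_big/=; apply: ler_sum => w _.
rewrite -mulr_suml ler_piMl// -natr_sum lern1.
have := fresh_hits_le1 d3 m0 u km S_level nk Jin w.
by rewrite -sum1dep_card [X in (X <= 1)%N -> _]big_mkcond.
Qed.

Lemma hit_predict u i n (F : coins m -> R) : (i < n < k)%N ->
  (forall w, 0 <= F w) ->
  (forall w w', (forall j, (j <= i)%N -> hit m0 u S j w = hit m0 u S j w') -> F w = F w') ->
  \sum_w (hit m0 u S n w)%:R * F w <= hit_bound (n - i) * \sum_w F w.
Proof.
move=> /andP[i_n nk] F0 FE.
have SF0 : 0 <= \sum_w F w by exact: sumr_ge0.
have ex : exists J, (n - i < 32 * 8 ^ J)%N.
  exists n; apply: leq_ltn_trans (leq_subr _ _) _.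
  by have := ltn_expl n (isT : (1 < 8)%N); lia.
have [J hJ minJ] := ex_minnP ex.
have Jm : (J < m)%N.
  suff Jn : (J <= m.-1)%N by rewrite -(prednK m0) ltnS.
  apply: minJ; have := ltn_expl m.-1 (isT : (1 < 8)%N); have := leq_trans nk km; lia.
apply: (@le_trans _ _ (16%:R ^- J * \sum_w F w)); last first.
  by rewrite ler_wpM2r// hit_bound_ge.
(* When the least scale is 0 the probability bound is 1. Otherwise it is [J.+1], and minimality
   makes the delay long enough for [J.+1] coins to be refreshed. *)
case: J hJ minJ Jm => [|J] hJ minJ Jm.
  rewrite expr0 invr1 mul1r; apply: ler_sum => w _.
  by rewrite ler_piMl// lern1 leq_b1.
apply: (hit_fresh_le nk _ F0 FE).
have : (32 * 8 ^ J <= n - i)%N.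
  by rewrite leqNgt; apply/negP => /minJ; rewrite ltnn.
by move: i_n; lia.
Qed.

End fixed_path.

Lemma torus_pos_start_inj w n : injective (fun u : torus m d => torus_pos m0 u w n).
Proof.
move=> u u' /= e; apply/ffunP => i; apply: val_inj.
have := congr1 val (congr1 (fun f : torus m d => f i) e).
by rewrite !ffunE /= => /eqP; rewrite eqn_modDr !modn_small// => /eqP.
Qed.

Lemma level_path_inj k u w : (k <= m)%N ->
  {in torus_path m0 k u w &, injective (@level d m)}.
Proof.
move=> km v v' /mem_torus_path[i ik ->] /mem_torus_path[j jk ->].
rewrite !(level_torus_pos d3)//; last 2 first.
- exact: leq_trans km.
- exact: leq_trans km.
move=> /eqP; rewrite eqn_modDl !modn_small; last 2 first.
- exact: leq_trans km.
- exact: leq_trans km.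
by move=> /eqP ->.
Qed.

Lemma card_path_meet k u w (S : pred (torus m d)) : (k <= m)%N ->
  #|[set v in torus_path m0 k u w | v \in S]%SET| =
  (\sum_(0 <= i < k) hit m0 u S i w)%N.
Proof.
move=> km; rewrite -sum1_card.
under eq_bigl do rewrite inE.
rewrite big_mkcondr/= -(big_uniq _ (torus_path_uniq d3 m0 u w km)).
rewrite big_mkord big_tuple; apply: eq_bigr => i _.
by rewrite tnth_mktuple.
Qed.

(** The path [p'] is frozen and [p] averaged. The hypothesis on [l] gives
    [l / (1 - 64 * l) <= 2 * l], and the mean number of hits is at most [k ^ 2 / m ^ d <= m ^- 1],
    since [k <= m] and [d >= 3]. *)
Lemma path_meet_moment k (l : R) (p' : torus m d * coins m) :
  (k <= m)%N -> 0 <= l -> l * 64%:R <= 2^-1 ->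
  \sum_(p : torus m d * coins m)
    (1 + l) ^+ #|[set v in torus_path m0 k p.1 p.2 | v \in torus_path m0 k p'.1 p'.2]%SET|
  <= #|{: torus m d * coins m}|%:R * (1 + 2 * l / m%:R).
Proof.
move=> km l0 l64; set S := (torus_path m0 k p'.1 p'.2).
pose h n (p : torus m d * coins m) := hit m0 p.1 (mem S) n p.2.
apply: (@le_trans _ _ (\sum_p \prod_(0 <= i < k) (1 + l * (h i p)%:R))).
  apply: ler_sum => p _; rewrite card_path_meet//.
  rewrite expr_sum le_eqVlt; apply/orP; left; apply/eqP.
  apply: eq_bigr => i _; rewrite /h; case: hit; rewrite ?mulr1 ?mulr0 ?addr0//.
apply: (@le_trans _ _ (#|{: torus m d * coins m}|%:R + l / (1 - l * 64%:R) *
   \sum_p \sum_(0 <= n < k) (h n p)%:R)).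
  apply: (@sum_prod_hits_le _ _ h l l0 hit_bound).
  - move=> n i F ink F0 FE.
    rewrite sum_pair [X in _ * X]sum_pair mulr_sumr.
    apply: ler_sum => u _; apply: (hit_predict km) => //.
      exact: level_path_inj.
    by move=> w w' hw; apply: FE => j ji; exact: hw.
  - exact: hit_bound_ge0.
  - exact: sum_hit_bound_le.
  - by apply: le_lt_trans l64 _; lra.
(* For a fixed time and fixed coins, the position is an injective function of the starting point, so
   at most [k] starting points give a hit. *)
have hits : (\sum_p \sum_(0 <= n < k) (h n p) <= k * k * #|coins m|)%N.
  rewrite exchange_big/=.
  apply: (@leq_trans (\sum_(0 <= n < k) k * #|coins m|)); last first.
    by rewrite sum_nat_const_nat subn0 mulnA.
  apply: leq_sum => n _.
  rewrite (sum_pair (fun p => nat_of_bool (h n p))) exchange_big/=.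
  rewrite mulnC -sum_nat_const; apply: leq_sum => w _.
  apply: (@leq_trans (size S)); last by rewrite size_tuple.
  rewrite -big_mkcond/= sum1_card -(card_imset _ (@torus_pos_start_inj w n)).
  apply: leq_trans (card_size S); apply: subset_leq_card; apply/fintype.subsetP => v.
  by move=> /imsetP[u]; rewrite /h /hit /= => uS ->.
rewrite [leRHS]mulrDr mulr1 lerD2l.
apply: (@le_trans _ _ (2 * l * (k * k * #|coins m|)%N%:R)).
  apply: ler_pM.
  - by rewrite divr_ge0// subr_ge0; lra.
  - by apply: sumr_ge0 => p _; exact: sumr_ge0.
  - by rewrite ler_pdivrMr; nra.
  - rewrite -(ler_nat R) natr_sum in hits; apply: le_trans hits.
    by apply: ler_sum => p _; rewrite natr_sum.
have mR : 0 < m%:R :> R by rewrite ltr0n.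
have cT : #|torus m d| = (m ^ d)%N by rewrite card_ffun !card_ord.
have hN : (k * k * #|coins m| * m <= #|{: torus m d * coins m}|)%N.
  rewrite card_prod cT mulnAC leq_mul2r; apply/orP; right.
  case: d d3 => [|[|[|d']]]// _; rewrite !expnS.
  have md : (0 < m ^ d')%N by rewrite expn_gt0 m0.
  rewrite mulnC leq_mul2l; apply/orP; right; apply: leq_mul => //.
  by apply: (leq_trans km); rewrite leq_pmulr.
rewrite [leRHS]mulrA ler_pdivlMr// [leRHS]mulrC -[leLHS]mulrA.
apply: ler_wpM2l; first by rewrite mulr_ge0.
by rewrite -natrM ler_nat.
Qed.

End moment.

(** * Counting paths in a graph of bounded degree *)

Section count.
Local Open Scope nat_scope.
Context (V : finType) (e : rel V) (nbrs : V -> seq V) (D : nat).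
Hypothesis nbrsP : forall u v, e u v -> v \in nbrs u.
Hypothesis size_nbrs : forall u, size (nbrs u) <= D.

Fixpoint walks (n : nat) (u : V) : seq (seq V) :=
  if n is n'.+1 then [seq v :: p | v <- nbrs u, p <- walks n' v] else [:: [::]].

Lemma size_walks n u : size (walks n u) <= D ^ n.
Proof.
elim: n u => [//|n IH] u /=; rewrite size_allpairs_dep expnS.
apply: (@leq_trans (size (nbrs u) * D ^ n)); last by rewrite leq_mul2r size_nbrs orbT.
elim: (nbrs u) => [//|v s IHs] /=; rewrite mulSn.
by apply: leq_add => //; exact: IHs.
Qed.

Lemma mem_walks u p : path e u p -> p \in walks (size p) u.
Proof.
elim: p u => [//|v p IH] u /= /andP[uv vp].
by apply/allpairsPdep; exists v, p; split; [exact: nbrsP|exact: IH|].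
Qed.

(** A walk is encoded by its first node and its successive choices among at most [D] neighbours. *)
Lemma card_sorted_tuple k : 0 < k ->
  #|[pred S : k.-tuple V | sorted e S]| <= #|V| * D ^ k.-1.
Proof.
case: k => // k _; pose l := [seq v :: p | v <- enum V, p <- walks k v].
apply: (@leq_trans (size l)); last first.
  rewrite /l size_allpairs_dep cardE; elim: (enum V) => [//|v s IHs] /=.
  by rewrite mulSn; apply: leq_add => //; exact: size_walks.
rewrite cardE -(size_map val); apply: uniq_leq_size.
  by rewrite (map_inj_uniq val_inj) enum_uniq.
move=> s /mapP[S]; rewrite mem_enum inE => sS ->.
case/tupleP: S sS => v p /= vp; apply/allpairsPdep; exists v, (tval p).
split; rewrite ?mem_enum//.
by have := mem_walks vp; rewrite size_tuple.
Qed.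

End count.

Definition torus_nbr m d (u : torus m d) (ib : 'I_d * bool) : torus m d :=
  [ffun j => if j == ib.1 then if ib.2 then ordS (u j) else ord_pred (u j) else u j].

(** Self-avoidance is dropped: each step chooses one of [d] axes and one of two directions. *)
Lemma card_torus_paths m d k : (0 < k)%N ->
  (#|[pred S : k.-tuple (torus m d) | self_avoiding_path (@torus_adj m d) S]| <=
   m ^ d * (2 * d) ^ k.-1)%N.
Proof.
move=> k0; apply: (@leq_trans #|[pred S : k.-tuple (torus m d) | sorted (@torus_adj m d) S]|).
  by apply: subset_leq_card; apply/fintype.subsetP => S; rewrite !inE => /andP[].
have -> : (m ^ d = #|torus m d|)%N by rewrite card_ffun !card_ord.
apply: (@card_sorted_tuple _ _ (fun u => [seq torus_nbr u ib | ib <- enum {: 'I_d * bool}])) => //.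
  move=> u v /existsP[i /andP[uv /forallP vE]].
  have {}vE j : j != i -> v j = u j by move=> ji; have := vE j; rewrite ji => /eqP.
  apply/mapP; exists (i, v i == ordS (u i)); first by rewrite mem_enum.
  apply/ffunP => j; rewrite ffunE /=; have [->|ji] := eqVneq j i; last exact: vE.
  by case: eqP uv => [->|_]//= /eqP ->; rewrite ordSK.
by move=> u; rewrite size_map -cardE card_prod card_ord card_bool mulnC.
Qed.

(** * Gaussian integration *)

Local Open Scope classical_set_scope.

Section null_integral.
Context (R : realType).
Local Notation phi := (@normal_pdf R 0 1).
Local Notation leb := (@lebesgue_measure R).

Lemma integral_tuple_lebesgueS n (f : n.+1.-tuple R -> \bar R) :
  measurable_fun [set: n.+1.-tuple R] f -> (forall t, 0 <= f t)%E ->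
  (\int[tuple_lebesgue R n.+1]_t f t =
   \int[leb]_y \int[tuple_lebesgue R n]_t f [tuple of y :: t])%E.
Proof.
move=> mf f0.
rewrite [LHS](_ : _ = \int[pushforward (leb \x tuple_lebesgue R n)
    (@cons_pair R n)]_t f t)%E; last by [].
rewrite ge0_integral_pushforward//; last exact: measurable_cons_pair.
rewrite preimage_setT fubini_tonelli1//; last by move=> p; exact: f0.
by apply: measurableT_comp => //; exact: measurable_cons_pair.
Qed.

Definition tuple_null_pdf n (t : n.-tuple R) : R :=
  \prod_(i < n) phi (tnth t i).

Lemma tuple_null_pdf_ge0 n (t : n.-tuple R) : 0 <= tuple_null_pdf t.
Proof. by apply: prodr_ge0 => i _; exact: normal_pdf_ge0. Qed.

Lemma tuple_null_pdf_cons n y (t : n.-tuple R) :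
  tuple_null_pdf [tuple of y :: t] = phi y * tuple_null_pdf t.
Proof.
rewrite /tuple_null_pdf big_ord_recl; congr (_ * _).
by apply: eq_bigr => i _; rewrite tnthS.
Qed.

Lemma measurable_tuple_null_pdf n : measurable_fun setT (@tuple_null_pdf n).
Proof.
apply: measurable_prod => i _.
apply: measurableT_comp; first exact: measurable_normal_pdf.
exact: measurable_tnth.
Qed.

Definition set_tnth n (t : n.-tuple R) (i : 'I_n) (y : R) : n.-tuple R :=
  [tuple if j == i then y else tnth t j | j < n].

Lemma set_tnth0 n (t : n.-tuple R) x y :
  set_tnth [tuple of x :: t] ord0 y = [tuple of y :: t].
Proof.
apply: eq_from_tnth => i; rewrite tnth_mktuple.
by case: (unliftP ord0 i) => [j|] -> //=; rewrite !tnthS.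
Qed.

Lemma set_tnth_lift n (t : n.-tuple R) i x y :
  set_tnth [tuple of x :: t] (lift ord0 i) y = [tuple of x :: set_tnth t i y].
Proof.
apply: eq_from_tnth => j; rewrite tnth_mktuple.
case: (unliftP ord0 j) => [k|] -> //=; rewrite !tnthS tnth_mktuple.
by rewrite (inj_eq (@lift_inj _ _)).
Qed.

Lemma measurable_set_tnth n (i : 'I_n) : measurable_fun setT
  (fun p : n.-tuple R * measurableTypeR R => set_tnth p.1 i p.2).
Proof.
apply/measurable_fun_tnthP => j; rewrite /comp.
rewrite (_ : (fun _ => _) = fun p : n.-tuple R * measurableTypeR R =>
  if j == i then p.2 else tnth p.1 j); last first.
  by apply/funext => p; rewrite tnth_mktuple.
case: (j == i); first exact: measurable_snd.
exact: (measurableT_comp (measurable_tnth _) measurable_fst).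
Qed.

Definition gauss_avg (h : R -> \bar R) : \bar R := (\int[leb]_y (h y * (phi y)%:E))%E.

Definition null_avg n (g : n.-tuple R -> \bar R) : \bar R :=
  (\int[tuple_lebesgue R n]_t (g t * (tuple_null_pdf t)%:E))%E.

Lemma eq_gauss_avg h1 h2 : h1 =1 h2 -> gauss_avg h1 = gauss_avg h2.
Proof. by move=> /funext ->. Qed.

Lemma eq_null_avg n (g1 g2 : n.-tuple R -> \bar R) :
  g1 =1 g2 -> null_avg g1 = null_avg g2.
Proof. by move=> /funext ->. Qed.

Lemma gauss_avg_ge0 h : (forall y, 0 <= h y)%E -> (0 <= gauss_avg h)%E.
Proof.
move=> h0; apply: integral_ge0 => y _; apply: mule_ge0 => //.
by rewrite lee_fin normal_pdf_ge0.
Qed.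

Lemma measurable_phiE : measurable_fun setT (fun y : measurableTypeR R => (phi y)%:E).
Proof. by apply/measurable_EFinP; exact: measurable_normal_pdf. Qed.

Lemma measurable_tuple_null_pdfE n :
  measurable_fun setT (fun t : n.-tuple R => (tuple_null_pdf t)%:E).
Proof. by apply/measurable_EFinP; exact: measurable_tuple_null_pdf. Qed.

Lemma gauss_avg_cst (c : \bar R) : (0 <= c)%E -> gauss_avg (fun=> c) = c.
Proof.
move=> c0; rewrite /gauss_avg ge0_integralZl//.
- by rewrite integral_normal_pdf mule1.
- exact: measurable_phiE.
- by move=> y _; rewrite lee_fin normal_pdf_ge0.
Qed.

Lemma gauss_avgZr h (c : R) : measurable_fun setT (h : measurableTypeR R -> _) ->
  (forall y, 0 <= h y)%E -> 0 <= c ->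
  (\int[leb]_y (h y * (phi y)%:E * c%:E) = gauss_avg h * c%:E)%E.
Proof.
move=> mh h0 c0; rewrite ge0_integralZr//.
- by apply: emeasurable_funM => //; exact: measurable_phiE.
- by move=> y _; apply: mule_ge0 => //; rewrite lee_fin normal_pdf_ge0.
Qed.

Lemma measurable_gauss_avg d (T : measurableType d) (h : T -> R -> \bar R) :
  measurable_fun setT (fun p : T * measurableTypeR R => h p.1 p.2) ->
  (forall t y, 0 <= h t y)%E ->
  measurable_fun setT (fun t => gauss_avg (h t)).
Proof.
move=> mh h0.
apply: (@measurable_fun_fubini_tonelli_F _ _ _ _ _ _
  (fun p : T * measurableTypeR R => h p.1 p.2 * (phi p.2)%:E)%E).
- apply: emeasurable_funM => //.
  exact: (measurableT_comp measurable_phiE measurable_snd).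
- by move=> p; apply: mule_ge0 => //; rewrite lee_fin normal_pdf_ge0.
Qed.

Lemma null_avgS n (g : n.+1.-tuple R -> \bar R) :
  measurable_fun setT g -> (forall t, 0 <= g t)%E ->
  null_avg g = gauss_avg (fun y => null_avg (fun t => g [tuple of y :: t])).
Proof.
move=> mg g0; rewrite /null_avg integral_tuple_lebesgueS; first last.
- by move=> t; apply: mule_ge0 => //; rewrite lee_fin tuple_null_pdf_ge0.
- by apply: emeasurable_funM => //; exact: measurable_tuple_null_pdfE.
apply: eq_integral => y _; rewrite -ge0_integralZr//; first last.
- by rewrite lee_fin normal_pdf_ge0.
- by move=> t _; apply: mule_ge0 => //; rewrite lee_fin tuple_null_pdf_ge0.
- apply: emeasurable_funM; last exact: measurable_tuple_null_pdfE.
  apply: measurableT_comp => //.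
  exact: (measurableT_comp (@measurable_cons_pair R n) (measurable_pair1 y)).
by apply: eq_integral => t _; rewrite tuple_null_pdf_cons mulrC EFinM muleA.
Qed.

(** Under a product law, redrawing one coordinate independently changes no expectation. This is what
    allows nodes to be integrated out one at a time. *)
Lemma null_avg_resample n (i : 'I_n) (g : n.-tuple R -> \bar R) :
  measurable_fun setT g -> (forall t, 0 <= g t)%E ->
  null_avg g = null_avg (fun t => gauss_avg (fun y => g (set_tnth t i y))).
Proof.
elim: n i g => [[]//|n IH] i g mg g0.
have mgc : measurable_fun setT (fun p : measurableTypeR R * n.-tuple R => g [tuple of p.1 :: p.2]).
  by apply: measurableT_comp => //; exact: measurable_cons_pair.
have mgi j : measurable_fun setT (fun t : n.+1.-tuple R => gauss_avg (fun y => g (set_tnth t j y))).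
  apply: (@measurable_gauss_avg _ _ (fun t y => g (set_tnth t j y))) => //.
  by apply: measurableT_comp => //; exact: measurable_set_tnth.
rewrite (null_avgS mg g0) (null_avgS (mgi i)); last first.
  by move=> t; exact: gauss_avg_ge0.
case: (unliftP ord0 i) => [j|] ->.
  apply: eq_gauss_avg => y; rewrite (IH j); first last.
  - by move=> t; exact: g0.
  - exact: (measurableT_comp mgc (measurable_pair1 y)).
  by apply: eq_null_avg => t; apply: eq_gauss_avg => z; rewrite set_tnth_lift.
(* For the first coordinate, Tonelli moves its integral inside; the resampled function no longer
   depends on that coordinate, so averaging over it again is harmless. *)
transitivity (null_avg (fun t : n.-tuple R => gauss_avg (fun y => g [tuple of y :: t]))).
  rewrite /gauss_avg /null_avg.
  transitivity (\int[leb]_y \int[tuple_lebesgue R n]_t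
      (g [tuple of y :: t] * (phi y)%:E * (tuple_null_pdf t)%:E))%E.
    apply: eq_integral => y _; rewrite -ge0_integralZr//; first last.
    - by rewrite lee_fin normal_pdf_ge0.
    - by move=> t _; apply: mule_ge0 => //; rewrite lee_fin tuple_null_pdf_ge0.
    - apply: emeasurable_funM; last exact: measurable_tuple_null_pdfE.
      exact: (measurableT_comp mgc (measurable_pair1 y)).
    by apply: eq_integral => t _; rewrite muleAC.
  rewrite (@fubini_tonelli _ _ _ _ _ leb (tuple_lebesgue R n) (fun p =>
    g [tuple of p.1 :: p.2] * (phi p.1)%:E * (tuple_null_pdf p.2)%:E)%E)/=; first last.
  - by move=> p; rewrite !mule_ge0// lee_fin ?tuple_null_pdf_ge0 ?normal_pdf_ge0.
  - apply: emeasurable_funM; first apply: emeasurable_funM => //.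
    + exact: (measurableT_comp measurable_phiE measurable_fst).
    + exact: (measurableT_comp (@measurable_tuple_null_pdfE n) measurable_snd).
  apply: eq_integral => t _; rewrite gauss_avgZr//; last exact: tuple_null_pdf_ge0.
  exact: (measurableT_comp mgc (measurable_pair2 t)).
rewrite -[LHS]gauss_avg_cst.
  apply: eq_gauss_avg => y; apply: eq_null_avg => t.
  by apply: eq_gauss_avg => z; rewrite set_tnth0.
apply: integral_ge0 => t _; rewrite mule_ge0// ?lee_fin ?tuple_null_pdf_ge0//.
exact: gauss_avg_ge0.
Qed.

End null_integral.

(** * Gaussian integrals of the autoregressive kernel *)

Section kernel.
Context (R : realType).
Local Notation phi := (@normal_pdf R 0 1).
Local Notation leb := (@lebesgue_measure R).
Implicit Types (a b c r s u v y : R).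


Lemma sqrtr_expR (x : R) : Num.sqrt (expR x) = expR (x / 2).
Proof.
have -> : expR x = expR (x / 2) ^+ 2 by rewrite -expRM_natl; congr expR; lra.
by rewrite sqrtr_sqr ger0_norm// expR_ge0.
Qed.

(** Completing the square: the integrand is a constant times the density of mean [c / a] and
    variance [a^-1]. Writing the quadratic coefficient with [a - 1] absorbs the factor [phi]. *)
Lemma gauss_avg_expR (h : R -> R) a c d : 0 < a ->
  (forall y, h y = expR (- (a - 1) / 2 * y ^+ 2 + c * y + d)) ->
  gauss_avg (fun y => (h y)%:E) = (expR (c ^+ 2 / (2 * a) + d) / Num.sqrt a)%:E.
Proof.
move=> a0 hE.
have sa0 : 0 < Num.sqrt a by rewrite sqrtr_gt0.
pose s := (Num.sqrt a)^-1; have s0 : s != 0 by rewrite invr_eq0 gt_eqF.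
have s2 : s ^+ 2 = a^-1 by rewrite exprVn sqr_sqrtr// ltW.
pose K := expR (c ^+ 2 / (2 * a) + d) / Num.sqrt a; rewrite -/K.
rewrite /gauss_avg.
transitivity (\int[leb]_y (K%:E * (normal_pdf (c / a) s y)%:E))%E.
  apply: eq_integral => y _; rewrite -!EFinM; congr EFin.
  rewrite hE !normal_pdfE// /normal_peak /normal_fun s2.
  have -> : Num.sqrt (a^-1 * pi *+ 2) = (Num.sqrt a)^-1 * Num.sqrt (1 ^+ 2 * pi *+ 2) :> R.
    rewrite -mulrnAr sqrtrM ?invr_ge0 ?(ltW a0)// expr1n mul1r.
    by rewrite sqrtrV// ltW.
  set P := Num.sqrt (_ *+ _) in |- *.
  have P0 : P != 0.
    by rewrite gt_eqF// sqrtr_gt0 expr1n mul1r mulrn_wgt0// pi_gt0.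
  set B := - (y - 0) ^+ 2 / _; set D := - (y - c / a) ^+ 2 / _.
  transitivity (P^-1 * expR (- (a - 1) / 2 * y ^+ 2 + c * y + d + B)).
    by rewrite [in RHS]expRD; ring.
  have -> : - (a - 1) / 2 * y ^+ 2 + c * y + d + B = c ^+ 2 / (2 * a) + d + D.
    by rewrite /B /D; field; rewrite gt_eqF.
  by rewrite [in LHS]expRD /K; field; rewrite P0 gt_eqF.
rewrite ge0_integralZl//.
- by rewrite integral_normal_pdf mule1.
- by apply/measurable_EFinP; exact: measurable_normal_pdf.
- by move=> y _; rewrite lee_fin normal_pdf_ge0.
- by rewrite lee_fin mulr_ge0 ?expR_ge0// invr_ge0 ltW.
Qed.

(** The Mehler kernel: the density of N(r u, 1 - r^2) at [v] divided by that of N(0, 1). *)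
Definition ar_kernel r u v : R :=
  (Num.sqrt (1 - r ^+ 2))^-1 *
  expR (- (r ^+ 2 * u ^+ 2 - 2 * r * u * v + r ^+ 2 * v ^+ 2) /
        (2 * (1 - r ^+ 2))).

Lemma ar_kernel_ge0 r u v : 0 <= ar_kernel r u v.
Proof. by rewrite mulr_ge0 ?expR_ge0// invr_ge0 sqrtr_ge0. Qed.

Lemma ar_kernelC r u v : ar_kernel r u v = ar_kernel r v u.
Proof.
rewrite /ar_kernel; have -> : r ^+ 2 * u ^+ 2 - 2 * r * u * v + r ^+ 2 * v ^+ 2 =
  r ^+ 2 * v ^+ 2 - 2 * r * v * u + r ^+ 2 * u ^+ 2 by ring.
by [].
Qed.

Lemma ar_kernel0 u v : ar_kernel 0 u v = 1.
Proof.
rewrite /ar_kernel expr0n/= subr0 sqrtr1 invr1 mul1r -[RHS]expR0; congr expR.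
by field.
Qed.

Lemma subr1_sqr_gt0 r : `|r| < 1 -> 0 < 1 - r ^+ 2.
Proof. by move=> r1; rewrite subr_gt0 -real_normK ?num_real// expr_lt1. Qed.

Lemma gauss_avg_ar_kernel r u : `|r| < 1 ->
  gauss_avg (fun y => (ar_kernel r u y)%:E) = 1%E.
Proof.
move=> /subr1_sqr_gt0 r1.
have sr1 : Num.sqrt (1 - r ^+ 2) != 0 by rewrite gt_eqF// sqrtr_gt0.
have n1 : 1 - r ^+ 2 != 0 by rewrite gt_eqF.
rewrite (@gauss_avg_expR _ (1 - r ^+ 2)^-1 (r * u / (1 - r ^+ 2))
  (- r ^+ 2 * u ^+ 2 / (2 * (1 - r ^+ 2)) - ln (Num.sqrt (1 - r ^+ 2))))//.
- rewrite addrA expRD expRN lnK ?posrE ?sqrtr_gt0// sqrtrV ?(ltW r1)// invrK.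
  rewrite mulfVK// (_ : _ + _ = 0) ?expR0//.
  by field.
- by rewrite invr_gt0.
- move=> y; rewrite /ar_kernel addrA expRD expRN lnK ?posrE ?sqrtr_gt0//.
  rewrite mulrC; congr (expR _ / _); field.
  by rewrite n1.
Qed.

(** Chapman-Kolmogorov: along a Gaussian Markov chain, correlations multiply. *)
Lemma ar_kernel_comp r s u v : `|r| < 1 -> `|s| < 1 ->
  gauss_avg (fun y => (ar_kernel r u y * ar_kernel s y v)%:E) =
  (ar_kernel (r * s) u v)%:E.
Proof.
move=> r1 s1.
have rs1 : `|r * s| < 1 by rewrite normrM mulr_ilt1.
move: r1 s1 rs1 => /subr1_sqr_gt0 r1 /subr1_sqr_gt0 s1 /subr1_sqr_gt0 rs1.
have nr : 1 - r ^+ 2 != 0 by rewrite gt_eqF.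
have ns : 1 - s ^+ 2 != 0 by rewrite gt_eqF.
have nrs : 1 - (r * s) ^+ 2 != 0 by rewrite gt_eqF.
pose k := Num.sqrt (1 - r ^+ 2) * Num.sqrt (1 - s ^+ 2).
have k0 : 0 < k by rewrite mulr_gt0// sqrtr_gt0.
pose a := (1 - (r * s) ^+ 2) / ((1 - r ^+ 2) * (1 - s ^+ 2)).
have sa : Num.sqrt a = Num.sqrt (1 - (r * s) ^+ 2) / k.
  by rewrite /a sqrtrM ?ltW// sqrtrV ?sqrtrM// ltW// mulr_gt0.
rewrite (@gauss_avg_expR _ a
  (r * u / (1 - r ^+ 2) + s * v / (1 - s ^+ 2))
  (- r ^+ 2 * u ^+ 2 / (2 * (1 - r ^+ 2)) - s ^+ 2 * v ^+ 2 / (2 * (1 - s ^+ 2)) - ln k))//.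
- rewrite sa addrA expRD expRN lnK// invf_div mulrA mulfVK ?gt_eqF//.
  rewrite /ar_kernel mulrC; congr (_ * expR _)%:E.
  by rewrite /a; field; rewrite nr ns nrs.
- by rewrite /a divr_gt0// mulr_gt0.
- move=> y; rewrite /ar_kernel addrA expRD expRN lnK// /k invfM.
  rewrite mulrACA -expRD mulrC; congr (expR _ * _); rewrite /a; field.
    by rewrite nr ns.
  by rewrite !gt_eqF ?sqrtr_gt0.
Qed.

Definition kernel_growth b := (1 - b)^-1 ^+ 2.

(** Without the weight, the integral of the squared kernel is unbounded in [v] for nonzero [r]; the
    Lyapunov function absorbs this growth. The prefactor is controlled by [1 - b <= a], and the
    exponent by [4^-1 <= (1 - r ^+ 2) ^+ 2 * a] together with [16 * r ^+ 2 <= b]. *)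
Lemma ar_kernel_sqr_le r b v : 16 * r ^+ 2 <= b -> b <= 2^-1 ->
  (gauss_avg (fun y => (expR (b / 2 * y ^+ 2) * ar_kernel r y v ^+ 2)%:E) <=
  (kernel_growth b * expR (b / 2 * v ^+ 2))%:E)%E.
Proof.
move=> rb b2.
have r2 : 0 <= r ^+ 2 by rewrite sqr_ge0.
have r1 : 0 < 1 - r ^+ 2 by lra.
have nr : 1 - r ^+ 2 != 0 by rewrite gt_eqF.
have b1 : 0 < 1 - b by lra.
pose a := 1 - b + 2 * r ^+ 2 / (1 - r ^+ 2).
have q0 : 0 <= 2 * r ^+ 2 / (1 - r ^+ 2) by rewrite divr_ge0 ?(ltW r1)//; lra.
have a1 : 1 - b <= a by rewrite lerDl.
have a0 : 0 < a by lra.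
have na : a != 0 by rewrite gt_eqF.
rewrite (@gauss_avg_expR _ a (2 * r * v / (1 - r ^+ 2))
   (- r ^+ 2 * v ^+ 2 / (1 - r ^+ 2) - ln (1 - r ^+ 2)))//; last first.
  move=> y; rewrite /ar_kernel addrA expRD expRN lnK//.
  rewrite exprMn exprVn sqr_sqrtr ?(ltW r1)// -expRM_natl mulrCA -expRD mulrC.
  by congr (expR _ / _); rewrite /a; field.
rewrite lee_fin addrA expRD expRN lnK// -mulrA mulrC.
apply: ler_pM; rewrite ?mulr_ge0 ?invr_ge0 ?sqrtr_ge0 ?expR_ge0 ?(ltW r1)//.
  rewrite /kernel_growth expr2; apply: ler_pM; rewrite ?invr_ge0 ?sqrtr_ge0 ?(ltW r1)//.
    by rewrite lef_pV2 ?posrE//; lra.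
  rewrite lef_pV2 ?posrE ?sqrtr_gt0//.
  have : Num.sqrt ((1 - b) ^+ 2) <= Num.sqrt a.
    rewrite ler_sqrt//; apply: le_trans a1.
    by rewrite expr2 ler_piMl ?(ltW b1)//; lra.
    exact: ltW.
  by rewrite sqrtr_sqr ger0_norm// ltW.
rewrite ler_expR.
have -> : (2 * r * v / (1 - r ^+ 2)) ^+ 2 / (2 * a) + - r ^+ 2 * v ^+ 2 / (1 - r ^+ 2)
  = (2 * r ^+ 2 / ((1 - r ^+ 2) ^+ 2 * a) - r ^+ 2 / (1 - r ^+ 2)) * v ^+ 2.
  by field; rewrite na nr.
apply: ler_wpM2r; first exact: sqr_ge0.
have h0 : 0 <= r ^+ 2 / (1 - r ^+ 2) by rewrite divr_ge0// ltW.
suff : 2 * r ^+ 2 / ((1 - r ^+ 2) ^+ 2 * a) <= b / 2 by lra.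
rewrite ler_pdivrMr ?mulr_gt0 ?exprn_gt0//.
have : 4^-1 <= (1 - r ^+ 2) ^+ 2 * a.
  have -> : 4^-1 = 2^-1 * 2^-1 :> R by field.
  apply: ler_pM; rewrite ?invr_ge0//; last by lra.
  by rewrite expr2; nra.
by nra.
Qed.

(** The integral is the Hellinger affinity of N(r u, 1 - r^2) and N(0, 1). It is largest at [u = 0],
    where its square is [2 * k / (2 - r ^+ 2)], at most [2 * k]. *)
Lemma gauss_avg_sqrt_ar_kernel_le r u : `|r| < 1 ->
  (gauss_avg (fun y => (Num.sqrt (ar_kernel r u y))%:E) <=
  (Num.sqrt (2 * Num.sqrt (1 - r ^+ 2)))%:E)%E.
Proof.
move=> /subr1_sqr_gt0 r1.
have r2 : 0 <= r ^+ 2 by rewrite sqr_ge0.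
have nr : 1 - r ^+ 2 != 0 by rewrite gt_eqF.
have n2r : 2 - r ^+ 2 != 0 by rewrite gt_eqF//; lra.
pose k := Num.sqrt (1 - r ^+ 2).
have k0 : 0 < k by rewrite sqrtr_gt0.
have kk : k ^+ 2 = 1 - r ^+ 2 by rewrite sqr_sqrtr ?ltW.
pose a := (2 - r ^+ 2) / (2 * (1 - r ^+ 2)).
have a0 : 0 < a by rewrite divr_gt0 ?mulr_gt0//; lra.
have na : a != 0 by rewrite gt_eqF.
rewrite (@gauss_avg_expR _ a (r * u / (2 * (1 - r ^+ 2)))
   (- r ^+ 2 * u ^+ 2 / (4 * (1 - r ^+ 2)) - ln (Num.sqrt k)))//; last first.
  move=> y; rewrite /ar_kernel addrA expRD expRN lnK ?posrE ?sqrtr_gt0//.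
  rewrite sqrtrM ?invr_ge0 ?sqrtr_ge0// sqrtr_expR sqrtrV ?sqrtr_ge0// mulrC.
  by congr (expR _ / _); rewrite /a; field.
rewrite lee_fin addrA expRD expRN lnK ?posrE ?sqrtr_gt0//.
rewrite -mulrA -invfM -sqrtrM ?(ltW k0)//.
rewrite -[leRHS]mul1r; apply: ler_pM; rewrite ?expR_ge0 ?invr_ge0 ?sqrtr_ge0//.
  rewrite -[leRHS]expR0 ler_expR.
  have -> : (r * u / (2 * (1 - r ^+ 2))) ^+ 2 / (2 * a) +
    - r ^+ 2 * u ^+ 2 / (4 * (1 - r ^+ 2)) =
    - ((r * u) ^+ 2 / (4 * (2 - r ^+ 2))).
    by rewrite /a; field; rewrite nr n2r.
  by rewrite oppr_le0 divr_ge0 ?sqr_ge0//; lra.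
have ka0 : 0 < k * a by rewrite mulr_gt0.
have -> : (Num.sqrt (k * a))^-1 = Num.sqrt (k * a)^-1 by rewrite sqrtrV// ltW.
rewrite ler_sqrt ?mulr_gt0//.
have -> : (k * a)^-1 = (k ^+ 2 * a)^-1 * k by field; rewrite !gt_eqF.
rewrite ler_pM2r// kk.
have -> : (1 - r ^+ 2) * a = (2 - r ^+ 2) / 2 by rewrite /a; field.
rewrite -[leRHS]invrK lef_pV2 ?posrE ?invr_gt0//; lra.
Qed.

End kernel.

(** * Likelihood ratios along chains *)

Section null_expectation.
Context (R : realType) (V : finType).
Local Notation obs := (obs R V).
Implicit Types (g h : obs -> R) (t : obs) (v w : V).

Definition set_obs t v (y : R) : obs := set_tnth t (enum_rank v) y.

Lemma obs_at_set_obs t v y w :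
  obs_at (set_obs t v y) w = if w == v then y else obs_at t w.
Proof. by rewrite /obs_at /set_obs tnth_mktuple (inj_eq enum_rank_inj). Qed.

Lemma null_pdfE t : null_pdf t = tuple_null_pdf t.
Proof.
rewrite /null_pdf /tuple_null_pdf (reindex (@enum_val V predT)) /=; last first.
  by apply: onW_bij; exact: enum_val_bij.
apply: eq_big => [//|i _]; by rewrite /obs_at enum_valK.
Qed.

Lemma measurable_obs_at v : measurable_fun setT (fun t : obs => obs_at t v).
Proof. exact: measurable_tnth. Qed.

Definition null_E g : \bar R := null_avg (fun t : obs => (g t)%:E).

Lemma eq_null_E g h : g =1 h -> null_E g = null_E h.
Proof. by move=> /funext ->. Qed.

Lemma le_null_E g h : measurable_fun [set: obs] g -> (forall t, 0 <= g t) ->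
  measurable_fun [set: obs] h -> (forall t, g t <= h t) ->
  (null_E g <= null_E h)%E.
Proof.
move=> mg g0 mh gh; apply: ge0_le_integral => //.
- by move=> t _; rewrite mule_ge0 ?lee_fin ?tuple_null_pdf_ge0.
- apply: emeasurable_funM; first exact/measurable_EFinP.
  exact: measurable_tuple_null_pdfE.
- apply: emeasurable_funM; first exact/measurable_EFinP.
  exact: measurable_tuple_null_pdfE.
- by move=> t _; rewrite lee_wpmul2r ?lee_fin ?tuple_null_pdf_ge0.
Qed.

Lemma null_ED g h : measurable_fun [set: obs] g -> (forall t, 0 <= g t) ->
  measurable_fun [set: obs] h -> (forall t, 0 <= h t) ->
  null_E (fun t => g t + h t) = (null_E g + null_E h)%E.
Proof.
move=> mg g0 mh h0; rewrite /null_E /null_avg -ge0_integralD//.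
- by apply: eq_integral => t _; rewrite EFinD ge0_muleDl ?lee_fin.
- by move=> t _; rewrite mule_ge0 ?lee_fin ?tuple_null_pdf_ge0.
- apply: emeasurable_funM; first exact/measurable_EFinP.
  exact: measurable_tuple_null_pdfE.
- by move=> t _; rewrite mule_ge0 ?lee_fin ?tuple_null_pdf_ge0.
- apply: emeasurable_funM; first exact/measurable_EFinP.
  exact: measurable_tuple_null_pdfE.
Qed.

Lemma null_EZ (c : R) g : measurable_fun [set: obs] g -> (forall t, 0 <= g t) ->
  0 <= c -> null_E (fun t => c * g t) = (c%:E * null_E g)%E.
Proof.
move=> mg g0 c0; rewrite /null_E /null_avg -ge0_integralZl//.
- by apply: eq_integral => t _; rewrite EFinM muleA.
- apply: emeasurable_funM; first exact/measurable_EFinP.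
  exact: measurable_tuple_null_pdfE.
- by move=> t _; rewrite mule_ge0 ?lee_fin ?tuple_null_pdf_ge0.
Qed.

Lemma null_avg1 n : null_avg (fun=> 1%E : \bar R) (n := n) = 1%E.
Proof.
elim: n => [|n IH].
  rewrite /null_avg /= integral_dirac//.
    by rewrite diracE in_setT !mul1e /tuple_null_pdf big_ord0.
  by apply: emeasurable_funM => //; exact: measurable_tuple_null_pdfE.
rewrite null_avgS// -[RHS](@gauss_avg_cst R 1%E)//.
exact: eq_gauss_avg.
Qed.

Lemma null_E_cst (c : R) : 0 <= c -> null_E (fun=> c) = c%:E.
Proof.
move=> c0; rewrite -[in LHS](mulr1 c) null_EZ//.
by rewrite /null_E null_avg1 mule1.
Qed.

Lemma null_E_sum (I : Type) (r : seq I) (g : I -> obs -> R) :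
  (forall i, measurable_fun [set: obs] (g i)) -> (forall i t, 0 <= g i t) ->
  null_E (fun t => \sum_(i <- r) g i t) = (\sum_(i <- r) null_E (g i))%E.
Proof.
move=> mg g0; elim: r => [|i r IH].
  rewrite big_nil -[RHS](null_E_cst (lexx 0)).
  by apply: eq_null_E => t; rewrite big_nil.
rewrite big_cons -IH -null_ED//.
- by apply: eq_null_E => t; rewrite big_cons.
- exact: measurable_sum.
- by move=> t; exact: sumr_ge0.
Qed.

Lemma null_E_resample v g : measurable_fun [set: obs] g -> (forall t, 0 <= g t) ->
  null_E g = null_avg (fun t => gauss_avg (fun y => (g (set_obs t v y))%:E)).
Proof.
move=> mg g0; rewrite /null_E (@null_avg_resample _ _ (enum_rank v))//.
exact/measurable_EFinP.
Qed.

Lemma null_E_resample_eq v g h : measurable_fun [set: obs] g -> (forall t, 0 <= g t) ->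
  (forall t, gauss_avg (fun y => (g (set_obs t v y))%:E) = (h t)%:E) ->
  null_E g = null_E h.
Proof.
by move=> mg g0 gh; rewrite (null_E_resample v)//; apply: eq_null_avg => t.
Qed.

Lemma measurable_set_obs v : measurable_fun setT
  (fun p : obs * measurableTypeR R => set_obs p.1 v p.2).
Proof. exact: measurable_set_tnth. Qed.

Lemma null_E_resample_le v g h : measurable_fun [set: obs] g -> (forall t, 0 <= g t) ->
  measurable_fun [set: obs] h ->
  (forall t, gauss_avg (fun y => (g (set_obs t v y))%:E) <= (h t)%:E)%E ->
  (null_E g <= null_E h)%E.
Proof.
move=> mg g0 mh gh; rewrite (null_E_resample v)//.
have gg0 t : (0 <= gauss_avg (fun y => (g (set_obs t v y))%:E))%E.
  by apply: gauss_avg_ge0 => y; rewrite lee_fin.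
apply: ge0_le_integral => //.
- by move=> t _; rewrite mule_ge0 ?lee_fin ?tuple_null_pdf_ge0.
- apply: emeasurable_funM; last exact: measurable_tuple_null_pdfE.
  apply: (@measurable_gauss_avg _ _ _ (fun t y => (g (set_obs t v y))%:E)).
    apply/measurable_EFinP; apply: measurableT_comp => //.
    exact: measurable_set_obs.
  by move=> t y; rewrite lee_fin.
- apply: emeasurable_funM; first exact/measurable_EFinP.
  exact: measurable_tuple_null_pdfE.
- by move=> t _; rewrite lee_wpmul2r ?lee_fin ?tuple_null_pdf_ge0.
Qed.

End null_expectation.

(** * Moments of chain likelihood ratios and removal of nodes *)

Section chain.
Context (R : realType) (V : finType).
Local Notation obs := (obs R V).
Implicit Types (t : obs) (v w : V) (c : seq (R * V)) (p : R) (x : V -> R).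

Lemma measurable_sqrtr : measurable_fun setT (@Num.sqrt R).
Proof. by apply: continuous_measurable_fun; exact: sqrt_continuous. Qed.

Lemma gauss_avgMr (h : R -> R) (k : R) :
  measurable_fun setT (h : measurableTypeR R -> measurableTypeR R) ->
  (forall y, 0 <= h y) -> 0 <= k ->
  gauss_avg (fun y => (h y * k)%:E) = (gauss_avg (fun y => (h y)%:E) * k%:E)%E.
Proof.
move=> mh h0 k0; rewrite -gauss_avgZr//; last exact/measurable_EFinP.
by apply: eq_integral => y _; rewrite EFinM muleAC.
Qed.

Lemma measurable_ar_kernel d (T : measurableType d) (r : R) (f g : T -> R) :
  measurable_fun setT f -> measurable_fun setT g ->
  measurable_fun setT (fun z => ar_kernel r (f z) (g z)).
Proof.
move=> mf mg; apply: measurable_funM => //; apply: measurableT_comp => //.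
apply: measurable_funM => //; apply: measurableT_comp => //.
apply: measurable_funD; first apply: measurable_funB.
- by apply: measurable_funM => //; exact: measurable_funX.
- by apply: measurable_funM => //; exact: measurable_funM.
- by apply: measurable_funM => //; exact: measurable_funX.
Qed.

(* The likelihood ratio of an inhomogeneous autoregressive chain along the nodes
   of [c]: each node comes with its correlation with the previous one, [p] being
   the value before the first node; the first correlation is meant to be 0. *)
Fixpoint chain_lr p c x : R :=
  if c is (r, v) :: c' then ar_kernel r p (x v) * chain_lr (x v) c' x else 1.

Definition chain_last p c x : R := last p [seq x rv.2 | rv <- c].

Definition nodes c : seq V := [seq rv.2 | rv <- c].

Lemma chain_lr_ge0 p c x : 0 <= chain_lr p c x.
Proof.
by elim: c p => [|[r v] c IH] p//=; rewrite mulr_ge0 ?ar_kernel_ge0.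
Qed.

Lemma chain_lr_rcons p c x r v :
  chain_lr p (rcons c (r, v)) x =
  chain_lr p c x * ar_kernel r (chain_last p c x) (x v).
Proof.
by elim: c p => [|[s w] c IH] p/=; rewrite ?mulr1 ?mul1r// IH mulrA.
Qed.

Lemma chain_last_rcons p c x r v : chain_last p (rcons c (r, v)) x = x v.
Proof. by rewrite /chain_last map_rcons last_rcons. Qed.

Lemma eq_chain_lr p c x y : {in nodes c, x =1 y} -> chain_lr p c x = chain_lr p c y.
Proof.
elim: c p => [//|[r v] c IH] p xy /=.
rewrite xy ?mem_head// IH// => w wc; apply: xy.
by rewrite inE wc orbT.
Qed.

Lemma eq_chain_last p c x y :
  {in nodes c, x =1 y} -> chain_last p c x = chain_last p c y.
Proof.
elim: c p => [//|[r v] c IH] p xy /=.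
rewrite /chain_last /= xy ?mem_head//; apply: IH => w wc; apply: xy.
by rewrite inE wc orbT.
Qed.

Lemma set_obs_in w t y c : w \notin nodes c ->
  {in nodes c, obs_at (set_obs t w y) =1 obs_at t}.
Proof.
move=> wc v vc; rewrite obs_at_set_obs; case: eqP => // vw.
by rewrite -vw vc in wc.
Qed.

Lemma chain_lr_set p c t w y : w \notin nodes c ->
  chain_lr p c (obs_at (set_obs t w y)) = chain_lr p c (obs_at t).
Proof. by move=> wc; apply: eq_chain_lr; exact: set_obs_in. Qed.

Lemma chain_last_set p c t w y : w \notin nodes c ->
  chain_last p c (obs_at (set_obs t w y)) = chain_last p c (obs_at t).
Proof. by move=> wc; apply: eq_chain_last; exact: set_obs_in. Qed.

Lemma measurable_chain_lr c (f : obs -> R) : measurable_fun setT f ->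
  measurable_fun setT (fun t => chain_lr (f t) c (obs_at t)).
Proof.
elim: c f => [|[r v] c IH] f mf//=.
apply: measurable_funM; last by apply: IH; exact: measurable_obs_at.
by apply: measurable_ar_kernel => //; exact: measurable_obs_at.
Qed.

Lemma measurable_chain_last p c :
  measurable_fun setT (fun t => chain_last p c (obs_at t)).
Proof.
case/lastP: c => [|c [r v]]//.
under eq_fun do rewrite chain_last_rcons.
exact: measurable_obs_at.
Qed.

Lemma nodes_rcons c r v : nodes (rcons c (r, v)) = rcons (nodes c) v.
Proof. by rewrite /nodes map_rcons. Qed.

Lemma null_E_chain_lr p c : uniq (nodes c) -> all (fun rv => `|rv.1| < 1) c ->
  null_E (fun t : obs => (chain_lr p c (obs_at t))%R) = 1%E.
Proof.
elim/last_ind: c => [|c [r v] IH]; first by rewrite null_E_cst.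
rewrite nodes_rcons rcons_uniq all_rcons/= => /andP[vc uc] /andP[r1 cb].
rewrite -IH//; apply: (null_E_resample_eq (v := v)).
- exact: measurable_chain_lr.
- by move=> t; exact: chain_lr_ge0.
- move=> t; under eq_gauss_avg.
    move=> y; rewrite chain_lr_rcons chain_lr_set// chain_last_set//.
    rewrite obs_at_set_obs eqxx mulrC; over.
  rewrite gauss_avgMr ?chain_lr_ge0//; last by move=> y; exact: ar_kernel_ge0.
    by rewrite gauss_avg_ar_kernel ?mul1e.
  exact: measurable_ar_kernel.
Qed.

(** Integrating out the last node turns its weight into the same weight on the previous node, at the
    cost of one factor [kernel_growth b]. *)
Lemma null_E_chain_lr_sqr b p c : 0 <= b -> b <= 2^-1 -> uniq (nodes c) ->
  all (fun rv => 16 * rv.1 ^+ 2 <= b) c ->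
  (null_E (fun t : obs => (chain_lr p c (obs_at t) ^+ 2 *
     expR (b / 2 * chain_last p c (obs_at t) ^+ 2))%R) <=
   (kernel_growth b ^+ size c * expR (b / 2 * p ^+ 2))%:E)%E.
Proof.
move=> b0 b2.
have g0 : 0 <= kernel_growth b by rewrite /kernel_growth sqr_ge0.
have mE p' c' : measurable_fun [set: obs] (fun t : obs => chain_lr p' c' (obs_at t) ^+ 2 *
     expR (b / 2 * chain_last p' c' (obs_at t) ^+ 2)).
  apply: measurable_funM; first by apply: measurable_funX; exact: measurable_chain_lr.
  apply: measurableT_comp => //; apply: measurable_funM => //.
  by apply: measurable_funX; exact: measurable_chain_last.
have E0 p' c' x : 0 <= chain_lr p' c' x ^+ 2 * expR (b / 2 * chain_last p' c' x ^+ 2).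
  by rewrite mulr_ge0 ?sqr_ge0 ?expR_ge0.
elim/last_ind: c => [|c [r v] IH].
  rewrite (@eq_null_E _ _ _ (fun=> expR (b / 2 * p ^+ 2))).
    by rewrite null_E_cst ?expR_ge0// mul1r.
  by move=> t; rewrite /= expr1n mul1r.
rewrite nodes_rcons rcons_uniq all_rcons/= => /andP[vc uc] /andP[r1 cb].
apply: (@le_trans _ _ (null_E (fun t : obs => (kernel_growth b * (chain_lr p c (obs_at t) ^+ 2 *
     expR (b / 2 * chain_last p c (obs_at t) ^+ 2)))%R))).
  apply: (null_E_resample_le (v := v)) => //.
    by apply: measurable_funM => //; exact: mE.
  move=> t; under eq_gauss_avg.
    move=> y; rewrite chain_lr_rcons chain_last_rcons chain_lr_set// chain_last_set//.
    rewrite obs_at_set_obs eqxx exprMn mulrAC [X in _ * X]mulrC -mulrA mulrC; over.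
  have := ar_kernel_sqr_le (chain_last p c (obs_at t)) r1 b2.
  rewrite gauss_avgMr ?sqr_ge0//.
  - move=> H; rewrite mulrA mulrAC [leRHS]EFinM; apply: lee_wpmul2r; first by rewrite lee_fin sqr_ge0.
    apply: le_trans H; rewrite le_eqVlt; apply/orP; left; apply/eqP.
    by apply: eq_gauss_avg => y; rewrite ar_kernelC.
  - apply: measurable_funM; last by apply: measurable_funM; exact: measurable_ar_kernel.
    by apply: measurableT_comp => //; apply: measurable_funM => //; exact: measurable_funX.
  - by move=> y; rewrite mulr_ge0 ?sqr_ge0 ?expR_ge0.
rewrite null_EZ// size_rcons exprS -mulrA [leRHS]EFinM.
by apply: lee_wpmul2l; [rewrite lee_fin|exact: IH].
Qed.

(** The affinity bound is uniform in the previous value, so the last node can be integrated out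
    without any weight. *)
Lemma null_E_sqrt_chain_lr p c : uniq (nodes c) -> all (fun rv => `|rv.1| < 1) c ->
  (null_E (fun t : obs => (Num.sqrt (chain_lr p c (obs_at t)))%R) <=
   (\prod_(rv <- c) Num.sqrt (2 * Num.sqrt (1 - rv.1 ^+ 2)))%:E)%E.
Proof.
have mE p' c' : measurable_fun [set: obs] (fun t : obs => Num.sqrt (chain_lr p' c' (obs_at t))).
  by apply: (measurableT_comp measurable_sqrtr); exact: measurable_chain_lr.
elim/last_ind: c => [|c [r v] IH].
  by rewrite big_nil /= sqrtr1 null_E_cst.
rewrite nodes_rcons rcons_uniq all_rcons/= => /andP[vc uc] /andP[r1 cb].
set e := Num.sqrt (2 * Num.sqrt (1 - r ^+ 2)).
apply: (@le_trans _ _ (null_E (fun t : obs => (e * Num.sqrt (chain_lr p c (obs_at t)))%R))).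
  apply: (null_E_resample_le (v := v)).
  - exact: mE.
  - by move=> t; exact: sqrtr_ge0.
  - by apply: measurable_funM => //; exact: mE.
  move=> t; under eq_gauss_avg.
    move=> y; rewrite chain_lr_rcons chain_lr_set// chain_last_set//.
    rewrite obs_at_set_obs eqxx sqrtrM ?chain_lr_ge0// mulrC; over.
  rewrite gauss_avgMr ?sqrtr_ge0//.
  - rewrite [leRHS]EFinM; apply: lee_wpmul2r; first by rewrite lee_fin sqrtr_ge0.
    exact: gauss_avg_sqrt_ar_kernel_le.
  - by apply: (measurableT_comp measurable_sqrtr); exact: measurable_ar_kernel.
rewrite null_EZ ?sqrtr_ge0// big_rcons/= mulrC [leRHS]EFinM.
by apply: lee_wpmul2l; [rewrite lee_fin sqrtr_ge0|exact: IH].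
Qed.

(** The chain with node [w] marginalized: its correlation is multiplied into that of the next node,
    if there is one. *)
Fixpoint chain_rem w c : seq (R * V) :=
  if c is (r, v) :: c' then
    if v == w then if c' is (s, u) :: c'' then (r * s, u) :: c'' else [::]
    else (r, v) :: chain_rem w c'
  else [::].

Lemma nodes_chain_rem w c : nodes (chain_rem w c) = rem w (nodes c).
Proof.
elim: c => [//|[r v] c IH] /=; case: eqP => _; last by rewrite /= IH.
by case: c {IH} => [|[s u] c].
Qed.

Lemma all_chain_rem (P : pred R) w c :
  (forall r s, P r -> P s -> P (r * s)) ->
  all (fun rv => P rv.1) c -> all (fun rv => P rv.1) (chain_rem w c).
Proof.
move=> PM; elim: c => [//|[r v] c IH] /= /andP[Pr Pc].
case: eqP => _; last by rewrite /= Pr IH.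
by case: c Pc {IH} => [|[s u] c] //= /andP[Ps ->]; rewrite PM.
Qed.

(** When [w] has a successor this is Chapman-Kolmogorov; when it is last, its kernel integrates to
    1. *)
Lemma gauss_avg_chain_lr p c w t : uniq (nodes c) -> w \in nodes c ->
  all (fun rv => `|rv.1| < 1) c ->
  gauss_avg (fun y => (chain_lr p c (obs_at (set_obs t w y)))%:E) =
  (chain_lr p (chain_rem w c) (obs_at t))%:E.
Proof.
elim: c p => [//|[r v] c IH] p /= /andP[vc uc]; rewrite inE => wc /andP[r1 cb].
have [vw|vw] := eqVneq v w.
  rewrite -vw; case: c vc uc cb {IH wc} => [|[s u] c] /= vc uc cb.
    under eq_gauss_avg do rewrite mulr1 obs_at_set_obs eqxx.
    exact: gauss_avg_ar_kernel.
  move: vc cb; rewrite inE negb_or => /andP[vu vc] /andP[s1 cb].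
  under eq_gauss_avg.
    move=> y; rewrite !obs_at_set_obs eqxx eq_sym (negbTE vu) chain_lr_set//.
    rewrite mulrA; over.
  rewrite gauss_avgMr ?chain_lr_ge0//.
  - by rewrite ar_kernel_comp.
  - by apply: measurable_funM; exact: measurable_ar_kernel.
  - by move=> y; rewrite mulr_ge0 ?ar_kernel_ge0.
under eq_gauss_avg do rewrite obs_at_set_obs (negbTE vw) mulrC.
have {}wc : w \in nodes c by move: wc; rewrite eq_sym (negbTE vw).
rewrite gauss_avgMr ?ar_kernel_ge0//.
- by rewrite IH// -EFinM mulrC.
- have mf : measurable_fun setT (fun y : measurableTypeR R => set_obs t w y).
    exact: (measurableT_comp (@measurable_set_obs R V w) (measurable_pair1 t)).
  by apply: (measurableT_comp (@measurable_chain_lr c (fun=> obs_at t v) _) mf).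
- by move=> y; exact: chain_lr_ge0.
Qed.

(** A node of [c] outside [c'] appears in one factor only and can be marginalized; this is repeated
    until none is left. [P] is a smallness condition on correlations, stable under the products that
    marginalization creates. *)
Lemma null_E_chain_reduce (P : pred R) c c' :
  (forall r, P r -> `|r| < 1) -> (forall r s, P r -> P s -> P (r * s)) ->
  uniq (nodes c) -> all (fun rv => P rv.1) c ->
  exists c1, [/\ uniq (nodes c1), all (fun rv => P rv.1) c1,
    {subset nodes c1 <= nodes c}, {subset nodes c1 <= nodes c'} &
    null_E (fun t : obs => (chain_lr 0 c (obs_at t) * chain_lr 0 c' (obs_at t))%R) =
    null_E (fun t : obs => (chain_lr 0 c1 (obs_at t) * chain_lr 0 c' (obs_at t))%R)].
Proof.
move=> P1 PM.
have [n] := ubnP (size c); elim: n c => [//|n IH] c cn uc cP.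
have [sub|/allPn[w wc wc']] := boolP (all (mem (nodes c')) (nodes c)).
  by exists c; split => //; exact/allP.
have ur : uniq (nodes (chain_rem w c)) by rewrite nodes_chain_rem rem_uniq.
have rP := all_chain_rem w PM cP.
have sr : (size (chain_rem w c) < n)%N.
  rewrite -(size_map snd) -/(nodes _) nodes_chain_rem size_rem//.
  rewrite /nodes size_map; move: cn; rewrite ltnS; case: (c) wc => //= a l _.
have [c1 [u1 P1' s1 s1' E1]] := IH _ sr ur rP.
exists c1; split => //.
  by move=> v /s1; rewrite nodes_chain_rem; exact: mem_rem.
rewrite -E1; apply: (null_E_resample_eq (v := w)).
- by apply: measurable_funM; exact: measurable_chain_lr.
- by move=> t; rewrite mulr_ge0 ?chain_lr_ge0.
- move=> t; under eq_gauss_avg do rewrite [X in _ * X]chain_lr_set//.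
  rewrite gauss_avgMr ?chain_lr_ge0//.
  + rewrite gauss_avg_chain_lr// (sub_all _ cP)// => rv; exact: P1.
  + have mf : measurable_fun setT (fun y : measurableTypeR R => set_obs t w y).
      exact: (measurableT_comp (@measurable_set_obs R V w) (measurable_pair1 t)).
    by apply: (measurableT_comp (@measurable_chain_lr c (fun=> 0) _) mf).
  + by move=> y; exact: chain_lr_ge0.
Qed.

(** [c] is reduced against [c'], then [c'] against the reduced chain. Both resulting chains live on
    common nodes only, and the inequality of arithmetic and geometric means separates them into two
    squares. *)
Lemma null_E_chain_lrM_le b c c' : 0 <= b -> b <= 2^-1 ->
  uniq (nodes c) -> all (fun rv => 16 * rv.1 ^+ 2 <= b) c ->
  uniq (nodes c') -> all (fun rv => 16 * rv.1 ^+ 2 <= b) c' ->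
  (null_E (fun t : obs => (chain_lr 0 c (obs_at t) * chain_lr 0 c' (obs_at t))%R) <=
   (kernel_growth b ^+ #|[set v in nodes c | v \in nodes c']%SET|)%:E)%E.
Proof.
move=> b0 b2 uc cb uc' cb'.
pose P := fun r : R => 16 * r ^+ 2 <= b.
have P1 r : P r -> `|r| < 1.
  by rewrite /P => h; rewrite -(@expr_lt1 _ 2)// real_normK ?num_real//; lra.
have PM r s : P r -> P s -> P (r * s).
  rewrite /P => hr hs; rewrite exprMn.
  have r0 : 0 <= r ^+ 2 := sqr_ge0 r; have s0 : 0 <= s ^+ 2 := sqr_ge0 s.
  by apply: le_trans hr; rewrite ler_pM2l// ler_piMr//; lra.
have [c1 [u1 p1 s1 s1' ->]] := null_E_chain_reduce c' P1 PM uc cb.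
under eq_null_E do rewrite mulrC.
have [c2 [u2 p2 s2 s2' ->]] := null_E_chain_reduce c1 P1 PM uc' cb'.
set M := kernel_growth b; set N := #|_|.
have M1 : 1 <= M.
  by rewrite /M /kernel_growth exprn_ege1// -[leLHS]invr1 lef_pV2 ?posrE; lra.
have sqr_le c0 : uniq (nodes c0) -> all (fun rv => P rv.1) c0 ->
    {subset nodes c0 <= nodes c} -> {subset nodes c0 <= nodes c'} ->
    (null_E (fun t : obs => (chain_lr 0 c0 (obs_at t) ^+ 2)%R) <= (M ^+ N)%:E)%E.
  move=> u0 p0 s0 s0'; apply: (@le_trans _ _ (M ^+ size c0)%:E).
    have := null_E_chain_lr_sqr 0 b0 b2 u0 p0.
    rewrite expr0n mulr0 expR0 mulr1; apply: le_trans; apply: le_null_E.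
    - by apply: measurable_funX; exact: measurable_chain_lr.
    - by move=> t; exact: sqr_ge0.
    - apply: measurable_funM; first by apply: measurable_funX; exact: measurable_chain_lr.
      apply: measurableT_comp => //; apply: measurable_funM => //.
      by apply: measurable_funX; exact: measurable_chain_last.
    - move=> t; rewrite ler_peMr ?sqr_ge0// -[leLHS]expR0 ler_expR.
      by rewrite mulr_ge0 ?sqr_ge0// divr_ge0.
  rewrite lee_fin ler_weXn2l// -(size_map snd) -/(nodes _).
  rewrite -(card_uniqP u0); apply: subset_leq_card; apply/fintype.subsetP => v v0.
  by rewrite !inE s0// s0'.
have [m1 m2] : measurable_fun [set: obs] (fun t => chain_lr 0 c1 (obs_at t) ^+ 2) /\
  measurable_fun [set: obs] (fun t => chain_lr 0 c2 (obs_at t) ^+ 2).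
  by split; apply: measurable_funX; exact: measurable_chain_lr.
apply: (@le_trans _ _ (null_E (fun t : obs => (2^-1 * chain_lr 0 c2 (obs_at t) ^+ 2
    + 2^-1 * chain_lr 0 c1 (obs_at t) ^+ 2)%R))).
  apply: le_null_E.
  - by apply: measurable_funM; exact: measurable_chain_lr.
  - by move=> t; rewrite mulr_ge0 ?chain_lr_ge0.
  - by apply: measurable_funD; exact: measurable_funM.
  - move=> t; have := sqr_ge0 (chain_lr 0 c2 (obs_at t) - chain_lr 0 c1 (obs_at t)).
    by rewrite sqrrB; lra.
rewrite null_ED; last 4 first.
- exact: measurable_funM.
- by move=> t; rewrite mulr_ge0 ?sqr_ge0.
- exact: measurable_funM.
- by move=> t; rewrite mulr_ge0 ?sqr_ge0.
rewrite !null_EZ//; try by move=> t; exact: sqr_ge0.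
have -> : M ^+ N = 2^-1 * M ^+ N + 2^-1 * M ^+ N by field.
rewrite EFinD !EFinM; apply: leeD; apply: lee_wpmul2l; rewrite ?lee_fin//.
- by apply: sqr_le => // v /s2' /s1.
- by apply: sqr_le => // v /s1'.
Qed.

End chain.

(** * Diagonalization of the autoregressive covariance and its density *)

Section ar_matrix.
Context (R : realType) (psi : R) (n : nat).
Hypothesis psi1 : `|psi| < 1.
Local Notation G := (ar_cov psi n.+1).

(* [ar_filter] maps the process to its innovations, whose covariance is
   diagonal. *)
Definition ar_filter : 'M[R]_n.+1 :=
  \matrix_(a, b) ((a == b)%:R - psi * (a == b.+1 :> nat)%:R).

Definition ar_innov : 'rV[R]_n.+1 :=
  \row_a (if a == 0 :> nat then 1 else 1 - psi ^+ 2).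

Lemma sum_ar_filter (a : 'I_n.+1) (f : nat -> R) :
  \sum_c ar_filter a c * f c = f a - psi * (if a == 0 :> nat then 0 else f a.-1).
Proof.
under eq_bigr do rewrite mxE mulrBl -mulrA.
rewrite sumrB -mulr_sumr; congr (_ - _ * _).
  rewrite (bigD1 a)//= eqxx mul1r big1 ?addr0// => c ca.
  by rewrite eq_sym (negbTE ca) mul0r.
case: eqP => [a0|/eqP a0].
  by rewrite big1// => c _; rewrite a0 mul0r.
have an : (a.-1 < n.+1)%N by rewrite (leq_ltn_trans (leq_pred _)).
rewrite (bigD1 (Ordinal an))//= prednK ?lt0n// eqxx mul1r big1 ?addr0//.
move=> c /eqP ca; case: eqP => [ac|_]; last by rewrite mul0r.
by case: ca; apply/val_inj; rewrite /= ac.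
Qed.

Lemma ar_filter_cov : ar_filter *m G *m ar_filter^T = diag_mx ar_innov.
Proof.
pose g (a b : nat) : R := psi ^+ `|a - b|%N.
have gE (a b : nat) : (a <= b)%N -> g a b = psi ^+ (b - a) /\ g b a = psi ^+ (b - a).
  by move=> ab; rewrite /g distnC distnEl.
apply/matrixP => a b; rewrite !mxE.
transitivity (\sum_c ar_filter b c *
   (g a c - psi * (if a == 0 :> nat then 0 else g a.-1 c))).
  apply: eq_bigr => c _; rewrite mxE [X in _ * X]mxE mulrC; congr (_ * _).
  rewrite -(sum_ar_filter a (g ^~ c)); apply: eq_bigr => e _.
  by rewrite [X in _ * X]mxE.
rewrite (sum_ar_filter b (fun c => g a c - psi * (if a == 0 :> nat then 0 else g a.-1 c))).
have [ab|] := eqVneq a b.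
  rewrite -ab mulr1n; case: eqP => [->|/eqP a0].
    by rewrite /g distnn expr0; ring.
  have [_ e1] := gE a.-1 a (leq_pred _).
  have [e2 _] := gE a.-1 a (leq_pred _).
  rewrite e1 e2 /g !distnn (_ : a - a.-1 = 1)%N ?expr1 ?expr0; first by ring.
  by rewrite -[in X in (X - _)%N](prednK (n := a)) ?lt0n// subSnn.
(* Off the diagonal, [psi ^+ (b - a)] is [psi] times [psi ^+ (b.-1 - a)] when [a < b], so filtering
   along [b] gives 0; the case [b < a] is symmetric. *)
rewrite -val_eqE mulr0n neq_ltn => /orP[] ab.
  have b0 : (b == 0 :> nat) = false by apply/negbTE; rewrite -lt0n (leq_ltn_trans _ ab).
  have ab1 : (a <= b.-1)%N by rewrite -ltnS prednK// (leq_trans _ ab).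
  have [k bk] : exists k, b = (a + k).+1 :> nat.
    by exists (b.-1 - a)%N; rewrite subnKC// prednK// (leq_trans _ ab).
  rewrite b0 bk /=.
  have [-> _] := gE a (a + k).+1 (leqW (leq_addr _ _)).
  have [-> _] := gE a (a + k)%N (leq_addr _ _).
  rewrite -addnS !addKn exprS; case: eqP => [_|/eqP a0]; first by ring.
  have [j aj] : exists j, a = j.+1 :> nat by exists a.-1; rewrite prednK// lt0n.
  rewrite aj /=.
  have [-> _] := gE j (j.+1 + k.+1)%N (leqW (leq_addr _ _)).
  have [-> _] := gE j (j.+1 + k)%N (leqW (leq_addr _ _)).
  rewrite addnS !addSn -!addnS !addKn !exprS; ring.
have a0 : (a == 0 :> nat) = false by apply/negbTE; rewrite -lt0n (leq_ltn_trans _ ab).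
have ba1 : (b <= a.-1)%N by rewrite -ltnS prednK// (leq_trans _ ab).
have [k bk] : exists k, a = (b + k).+1 :> nat.
  by exists (a.-1 - b)%N; rewrite subnKC// prednK// (leq_trans _ ab).
rewrite a0 bk /=.
have [_ ->] := gE b (b + k).+1 (leqW (leq_addr _ _)).
have [_ ->] := gE b (b + k)%N (leq_addr _ _).
rewrite -addnS !addKn exprS; case: eqP => [_|/eqP b0]; first by ring.
have [j aj] : exists j, b = j.+1 :> nat by exists b.-1; rewrite prednK// lt0n.
rewrite aj /=.
have [_ ->] := gE j (j.+1 + k.+1)%N (leqW (leq_addr _ _)).
have [_ ->] := gE j (j.+1 + k)%N (leqW (leq_addr _ _)).
rewrite addnS !addSn -!addnS !addKn !exprS; ring.
Qed.

Lemma det_ar_filter : \det ar_filter = 1.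
Proof.
rewrite det_trig; last first.
  apply/is_trig_mxP => a b ab; rewrite mxE -val_eqE ltn_eqF// ltn_eqF ?mulr0 ?subr0//.
  exact: ltnW.
by apply: big1 => a _; rewrite mxE eqxx ltn_eqF// mulr0 subr0.
Qed.

Lemma ar_innov_gt0 a : 0 < ar_innov 0 a.
Proof. by rewrite mxE; case: ifP => // _; exact: subr1_sqr_gt0. Qed.

Lemma det_ar_cov : \det G = \prod_a ar_innov 0 a.
Proof.
have := congr1 determinant ar_filter_cov.
by rewrite !det_mulmx det_tr det_ar_filter mul1r mulr1 det_diag.
Qed.

(** With [L] the filter and [D] the innovation variances, [L G L^T = D] gives the inverse of [G] as
    [L^T D^-1 L]. *)
Lemma ar_cov_quad (y : 'rV[R]_n.+1) :
  (y *m invmx G *m y^T) 0 0 = \sum_a ((y *m ar_filter^T) 0 a) ^+ 2 / ar_innov 0 a.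
Proof.
pose D' : 'M[R]_n.+1 := diag_mx (\row_a (ar_innov 0 a)^-1).
have DD' : diag_mx ar_innov *m D' = 1%:M.
  rewrite mulmx_diag -diag_const_mx; congr diag_mx; apply/rowP => a.
  by rewrite !mxE mulfV// gt_eqF//; have := ar_innov_gt0 a; rewrite mxE.
pose Q := ar_filter^T *m D' *m ar_filter.
have GQ : G *m Q = 1%:M.
  rewrite /Q !mulmxA; apply: mulmx1C.
  by rewrite !mulmxA ar_filter_cov.
have -> : invmx G = Q.
  by rewrite -[LHS]mulmx1 -GQ mulKmx//; case: (mulmx1_unit GQ).
rewrite /Q !mulmxA -(mulmxA _ ar_filter) -[ar_filter]trmxK -trmx_mul trmxK.
rewrite mxE; apply: eq_bigr => a _.
rewrite mul_mx_diag mxE [X in _ * X]mxE [X in _ * X * _]mxE.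
by rewrite mulrAC -expr2.
Qed.

Lemma sqrtr_prod (I : finType) (F : I -> R) : (forall i, 0 <= F i) ->
  Num.sqrt (\prod_i F i) = \prod_i Num.sqrt (F i).
Proof.
move=> F0; suff [] : 0 <= \prod_i F i /\ Num.sqrt (\prod_i F i) = \prod_i Num.sqrt (F i) by [].
elim/big_ind2: _ => [|x x' y y' [x0 ex] [y0 ey]|i _]; rewrite ?sqrtr1//.
by rewrite mulr_ge0// sqrtrM// ex ey.
Qed.

Definition ar_factor (y : 'rV[R]_n.+1) (a : 'I_n.+1) : R :=
  if a == 0 :> nat then 1 else ar_kernel psi (y 0 (inord a.-1)) (y 0 a).

(** The Markov factorization: each innovation density is a standard normal density times a kernel
    linking a value to the previous one. *)
Lemma gaussian_pdf_ar_cov (y : 'rV[R]_n.+1) :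
  gaussian_pdf G y = (\prod_a normal_pdf 0 1 (y 0 a)) * \prod_a ar_factor y a.
Proof.
have tpi : 0 < 2 * pi :> R by rewrite mulr_gt0// pi_gt0.
rewrite -big_split/= /gaussian_pdf ar_cov_quad det_ar_cov.
have -> : (2 * pi) ^+ n.+1 = \prod_(a < n.+1) (2 * pi) :> R.
  by rewrite prodr_const card_ord.
rewrite -big_split/= sqrtr_prod; last first.
  by move=> a; rewrite mulr_ge0// ?ltW// ar_innov_gt0.
rewrite -sumrN mulr_suml expR_sum -prodf_div; apply: eq_bigr => a _.
have -> : (y *m ar_filter^T) 0 a =
    y 0 a - psi * (if a == 0 :> nat then 0 else y 0 (inord a.-1)).
  rewrite mxE -[y 0 a in RHS]/(y 0 a) -{2}(inord_val a).
  rewrite -(sum_ar_filter a (fun i => y 0 (inord i))).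
  by apply: eq_bigr => c _; rewrite inord_val [X in _ * X]mxE mulrC.
rewrite normal_pdfE ?oner_eq0// /normal_peak /normal_fun expr1n mul1r subr0.
have -> : pi *+ 2 = 2 * pi :> R by rewrite mulr_natl.
rewrite /ar_factor mxE; case: ifP => [_|_].
  rewrite !mulr1 mulr0 subr0 mulrC; congr (_ * expR _).
  by field.
have r1 := subr1_sqr_gt0 psi1.
rewrite sqrtrM ?ltW// invfM /ar_kernel mulrACA -expRD mulrC; congr (_ * expR _).
by field; rewrite gt_eqF.
Qed.

End ar_matrix.

(** * The likelihood ratio of a path as a chain *)

Section path_likelihood.
Context (R : realType) (V : finType).

Definition path_chain (psi : R) (s : seq V) : seq (R * V) :=
  if s is v :: s' then (0, v) :: [seq (psi, w) | w <- s'] else [::].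

Lemma nodes_path_chain psi s : nodes (path_chain psi s) = s.
Proof.
case: s => [//|v s]; rewrite /nodes /= -map_comp; congr cons.
exact: map_id.
Qed.

Lemma chain_lr_ar (psi : R) v (s : seq V) (x : V -> R) :
  chain_lr (x v) [seq (psi, w) | w <- s] x =
  \prod_(0 <= i < size s) ar_kernel psi (x (nth v (v :: s) i)) (x (nth v s i)).
Proof.
rewrite big_mkord; elim: s v => [|w s IH] v /=; first by rewrite big_ord0.
rewrite big_ord_recl/= IH; congr (_ * _); apply: eq_bigr => i _ /=.
have -> : nth v (w :: s) i = nth w (w :: s) i.
  by apply: set_nth_default; rewrite /= ltnS ltnW.
by have -> : nth v s i = nth w s i by exact: set_nth_default.
Qed.

(** The standard normal factors on and off the path recombine into the null density, which leaves
    the kernels as likelihood ratio. *)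
Lemma path_pdfE (k : nat) (psi : R) (S : k.-tuple V) (t : obs R V) :
  `|psi| < 1 -> uniq S ->
  path_pdf psi S t = chain_lr 0 (path_chain psi S) (obs_at t) * null_pdf t.
Proof.
move=> psi1 uS; rewrite /path_pdf /null_pdf.
rewrite [in RHS](bigID (mem S))/= mulrA; congr (_ * _).
rewrite -[in RHS]big_uniq// [in RHS]big_tuple.
case: k S uS => [|n] S uS.
  rewrite (tuple0 S) big_ord0 /= mulr1 /gaussian_pdf expr0 mul1r det_mx00 sqrtr1 divr1.
  by rewrite mxE big_ord0 oppr0 mul0r expR0.
rewrite gaussian_pdf_ar_cov// mulrC; congr (_ * _); last first.
  by apply: eq_bigr => a _; rewrite mxE.
case/tupleP: S uS => v s uS /=; rewrite ar_kernel0 mul1r chain_lr_ar [in RHS]size_tuple big_mkord.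
rewrite big_ord_recl/= {1}/ar_factor/= mul1r; apply: eq_bigr => i _.
rewrite /ar_factor /= !mxE !(tnth_nth v)/= inordK//.
by rewrite add0n ltnS ltnW.
Qed.

End path_likelihood.

(** * Bounds on the minimax risk *)

Section risk.
Context (R : realType) (V : finType).
Local Notation obs := (obs R V).
Implicit Types psi : R.

Lemma density_law_null_E (h g : obs -> R) (A : set obs) :
  (forall t, g t = h t * null_pdf t) ->
  density_law g A = null_E (fun t => h t * \1_A t).
Proof.
move=> gE; rewrite /density_law integral_mkcond; apply: eq_integral => t _.
rewrite patchE /= gE null_pdfE indicE; case: ifP => tA; first by rewrite mulr1 EFinM.
by rewrite mulr0 mul0e.
Qed.

Lemma density_law_null_pdf (A : set obs) :
  density_law (@null_pdf R V) A = null_E (\1_A : obs -> R).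
Proof.
rewrite (@density_law_null_E (fun=> 1)); last by move=> t; rewrite mul1r.
by apply: eq_null_E => t; rewrite mul1r.
Qed.

Definition path_lr (psi : R) (s : seq V) (t : obs) : R :=
  chain_lr 0 (path_chain psi s) (obs_at t).

Lemma path_lr_ge0 psi s t : 0 <= path_lr psi s t.
Proof. exact: chain_lr_ge0. Qed.

Lemma measurable_path_lr psi s : measurable_fun [set: obs] (path_lr psi s).
Proof. exact: measurable_chain_lr. Qed.

Lemma density_law_path_pdf k psi (S : k.-tuple V) (A : set obs) :
  `|psi| < 1 -> uniq S ->
  density_law (path_pdf psi S) A = null_E (fun t => path_lr psi S t * \1_A t).
Proof.
by move=> psi1 uS; apply: density_law_null_E => t; exact: path_pdfE.
Qed.

Lemma all_path_chain (P : pred R) psi (s : seq V) : P 0 -> P psi ->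
  all (fun rv => P rv.1) (path_chain psi s).
Proof.
move=> P0 P1; case: s => [//|v s] /=; rewrite P0/= all_map.
by apply/allP => w _.
Qed.

Lemma null_E_path_lr psi s : `|psi| < 1 -> uniq s -> null_E (path_lr psi s) = 1%E.
Proof.
move=> psi1 us; apply: null_E_chain_lr; first by rewrite nodes_path_chain.
by apply: (@all_path_chain (fun r => `|r| < 1)) => //; rewrite normr0.
Qed.

Lemma null_E_path_lrM b psi (s s' : seq V) : 0 <= b -> b <= 2^-1 ->
  16 * psi ^+ 2 <= b -> uniq s -> uniq s' ->
  (null_E (fun t => (path_lr psi s t * path_lr psi s' t)%R) <=
   (kernel_growth b ^+ #|[set v in s | v \in s']%SET|)%:E)%E.
Proof.
move=> b0 b2 pb us us'.
have := @null_E_chain_lrM_le R V b (path_chain psi s) (path_chain psi s') b0 b2.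
rewrite !nodes_path_chain; apply => //.
- by apply: (@all_path_chain (fun r => 16 * r ^+ 2 <= b)) => //; rewrite expr0n mulr0.
- by apply: (@all_path_chain (fun r => 16 * r ^+ 2 <= b)) => //; rewrite expr0n mulr0.
Qed.

Lemma null_E_sqrt_path_lr psi s : `|psi| < 1 -> uniq s ->
  (null_E (fun t => Num.sqrt (path_lr psi s t)) <=
   (2 * Num.sqrt (2 * Num.sqrt (1 - psi ^+ 2)) ^+ (size s).-1)%:E)%E.
Proof.
move=> psi1 us.
have := @null_E_sqrt_chain_lr R V 0 (path_chain psi s).
rewrite nodes_path_chain => /(_ us) H.
apply: (le_trans (H _)).
  by apply: (@all_path_chain (fun r => `|r| < 1)) => //; rewrite normr0.
(* The constant 2 covers the first node, whose correlation 0 gives the factor [Num.sqrt 2], and also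
   the empty path. *)
rewrite lee_fin; case: s {us H} => [|v s] /=; first by rewrite big_nil expr0; lra.
rewrite big_cons/= big_map/= big_const_seq count_predT iter_mulr_1.
rewrite ler_wpM2r ?exprn_ge0 ?sqrtr_ge0//.
rewrite expr0n/= subr0 sqrtr1 mulr1 -[leRHS]ger0_norm// -sqrtr_sqr ler_sqrt; lra.
Qed.

(** Witnessed by the test that always rejects. *)
Lemma minimax_risk_le1 k (C : pred (k.-tuple V)) psi : `|psi| < 1 ->
  (minimax_risk (R := R) C psi <= 1)%E.
Proof.
move=> psi1; apply: ge_ereal_inf.
exists (worst_case_risk C psi (fun=> true)).
  by exists (fun=> true) => //; exact: measurable_cst.
rewrite /worst_case_risk density_law_null_pdf.
rewrite (@eq_null_E _ _ _ (fun=> 1)); last by move=> t; rewrite indicE mem_set.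
rewrite null_E_cst//; set M := \big[_/_]_(_ | _) _.
suff -> : M = 0%E by rewrite adde0.
apply/eqP; rewrite eq_le bigmax_ge_id andbT; apply: bigmax_le => // S _.
rewrite (_ : _ @^-1` [set false] = set0 :> set obs); last by apply/seteqP; split.
by rewrite /density_law integral_set0.
Qed.

Lemma density_law_ge0 n (g : n.-tuple R -> R) A : (forall t, 0 <= g t) ->
  (0 <= density_law g A)%E.
Proof. by move=> g0; apply: integral_ge0 => t _; rewrite lee_fin. Qed.

Lemma minimax_risk_ge0 k (C : pred (k.-tuple V)) psi : (0 <= minimax_risk (R := R) C psi)%E.
Proof.
apply: le_ereal_inf_tmp => _ [f mf <-]; apply: adde_ge0.
  by apply: density_law_ge0 => t; apply: prodr_ge0 => v _; exact: normal_pdf_ge0.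
exact: bigmax_ge_id.
Qed.

Lemma measurable_test (f : obs -> bool) (b : bool) :
  measurable_fun setT f -> measurable (f @^-1` [set b]).
Proof. by move=> mf; rewrite -[_ @^-1` _]setTI; exact: mf. Qed.

(* Second moment method: [e] is free and [1 + L / e] is compared pointwise with
   [1_A + L 1_B + e / 2 + (L^2 + 1) / (2 e)]. *)
Lemma minimax_risk_second_moment k (C : pred (k.-tuple V)) psi (I : finType)
    (S : I -> k.-tuple V) (D e : R) :
  `|psi| < 1 -> 0 < e -> (0 < #|I|)%N -> (forall i, C (S i)) -> (forall i, uniq (S i)) ->
  (\sum_i \sum_j null_E (fun t => (path_lr psi (S i) t * path_lr psi (S j) t)%R) <=
    (#|I|%:R ^+ 2 * (1 + D))%:E)%E ->
  ((1 - e / 2 - D / (2 * e))%:E <= minimax_risk (R := R) C psi)%E.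
Proof.
move=> psi1 e0 I0 CS uS secondm.
have N0 : 0 < #|I|%:R :> R by rewrite ltr0n.
apply: le_ereal_inf_tmp => _ [f mf <-].
rewrite /worst_case_risk density_law_null_pdf.
set A := f @^-1` [set true]; set B := f @^-1` [set false].
have mA : measurable A by exact: measurable_test.
have mB : measurable B by exact: measurable_test.
have ABE (t : obs) : (\1_B t : R) = 1 - \1_A t /\ ((\1_A t : R) = 0 \/ (\1_A t : R) = 1).
  rewrite !indicE; have [ft|ft] := boolP (f t).
    rewrite (mem_set (ft : A t)) (memNset (_ : ~ B t)); last by rewrite /B/= ft.
    by rewrite subrr; split => //; right.
  have Bt : B t by apply/negbTE.
  rewrite (mem_set Bt) memNset; last by rewrite /A/= (negbTE ft).
  by rewrite subr0; split => //; left.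
pose L t := #|I|%:R^-1 * \sum_i path_lr psi (S i) t.
have mS : measurable_fun [set: obs] (fun t => \sum_i path_lr psi (S i) t).
  by apply: measurable_sum => i; exact: measurable_path_lr.
have mL : measurable_fun [set: obs] L by exact: measurable_funM.
have L0 t : 0 <= L t.
  by rewrite mulr_ge0 ?invr_ge0 ?(ltW N0)// sumr_ge0// => i _; exact: path_lr_ge0.
have mI (E : set obs) : measurable E -> measurable_fun [set: obs] (\1_E : obs -> R).
  by move=> mE; exact: measurable_indic.
have I0' (E : set obs) t : 0 <= \1_E t :> R by rewrite indicE.
have EL : null_E L = 1%E.
  rewrite null_EZ//; last first.
  - by move=> t; apply: sumr_ge0 => i _; exact: path_lr_ge0.
  rewrite null_E_sum; last 2 first.
  - by move=> i; exact: measurable_path_lr.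
  - by move=> i t; exact: path_lr_ge0.
  under eq_bigr do rewrite null_E_path_lr//.
  by rewrite sumEFin sumr_const -EFinM mulVf// gt_eqF.
have EL2 : (null_E (fun t => (L t ^+ 2)%R) <= (1 + D)%:E)%E.
  rewrite (@eq_null_E _ _ _ (fun t => #|I|%:R ^- 2 *
    \sum_i \sum_j (path_lr psi (S i) t * path_lr psi (S j) t))); last first.
    move=> t; rewrite /L exprMn exprVn [X in _ * X = _]expr2 mulr_suml; congr (_ * _).
    by apply: eq_bigr => i _; rewrite mulr_sumr.
  rewrite null_EZ; last first.
  - by rewrite invr_ge0 exprn_ge0// ltW.
  - move=> t; apply: sumr_ge0 => i _; apply: sumr_ge0 => j _.
    by rewrite mulr_ge0// path_lr_ge0.
  - apply: measurable_sum => i; apply: measurable_sum => j.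
    by apply: measurable_funM; exact: measurable_path_lr.
  rewrite null_E_sum; last 2 first.
  - move=> i; apply: measurable_sum => j.
    by apply: measurable_funM; exact: measurable_path_lr.
  - by move=> i t; apply: sumr_ge0 => j _; rewrite mulr_ge0// path_lr_ge0.
  under eq_bigr => i _.
    rewrite null_E_sum; last 2 first.
    - by move=> j; apply: measurable_funM; exact: measurable_path_lr.
    - by move=> j t; rewrite mulr_ge0// path_lr_ge0.
    over.
  have -> : 1 + D = #|I|%:R ^- 2 * (#|I|%:R ^+ 2 * (1 + D)).
    by rewrite mulKf// expf_neq0// gt_eqF.
  rewrite [leRHS]EFinM; apply: lee_wpmul2l; last exact: secondm.
  by rewrite lee_fin invr_ge0 exprn_ge0// ltW.
set M := \big[_/_]_(_ | _) _.
(* The average over [i] of the errors of the second kind is at most their maximum [M]. *)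
have ELB : (null_E (fun t => (L t * \1_B t)%R) <= M)%E.
  rewrite (@eq_null_E _ _ _ (fun t => \sum_i #|I|%:R^-1 * (path_lr psi (S i) t * \1_B t))); last first.
    by move=> t; rewrite /L -mulrA mulr_suml mulr_sumr.
  rewrite null_E_sum; last 2 first.
  - move=> i; apply: measurable_funM => //; apply: measurable_funM; last exact: mI.
    exact: measurable_path_lr.
  - by move=> i t; rewrite !mulr_ge0 ?invr_ge0 ?(ltW N0)// path_lr_ge0.
  have M0 : (0 <= M)%E by exact: bigmax_ge_id.
  apply: (@le_trans _ _ (\sum_(i : I) ((#|I|%:R^-1)%:E * M)%E)).
    apply: lee_sum => i _; rewrite null_EZ; last first.
    - by rewrite invr_ge0 ltW.
    - by move=> t; rewrite mulr_ge0// path_lr_ge0.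
    - by apply: measurable_funM; [exact: measurable_path_lr|exact: mI].
    apply: lee_wpmul2l; first by rewrite lee_fin invr_ge0 ltW.
    rewrite -density_law_path_pdf//.
    exact: (le_bigmax_cond _ (fun S0 : k.-tuple V => density_law (path_pdf psi S0) B)).
  rewrite -ge0_sume_distrl; last by move=> i _; rewrite lee_fin invr_ge0 ltW.
  rewrite sumEFin sumr_const -(mulr_natl #|I|%:R^-1) mulfV ?mul1e//.
  by rewrite gt_eqF.
have ineq : (null_E (fun t => (1 + e^-1 * L t)%R) <=
   null_E (fun t => (\1_A t + L t * \1_B t + ((e / 2 + (2 * e)^-1) + (2 * e)^-1 * L t ^+ 2))%R))%E.
  apply: le_null_E.
  - by apply: measurable_funD => //; exact: measurable_funM.
  - by move=> t; rewrite addr_ge0// mulr_ge0// invr_ge0 ltW.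
  - apply: measurable_funD; first apply: measurable_funD; first exact: mI.
    + by apply: measurable_funM => //; exact: mI.
    + by apply: measurable_funD => //; apply: measurable_funM => //; exact: measurable_funX.
  - move=> t; have [-> AE] := ABE t.
    have e1 : (2 * e)^-1 = e^-1 / 2 by rewrite invfM mulrC.
    have ee : e * e^-1 = 1 by rewrite mulfV// gt_eqF.
    have ei0 : 0 < e^-1 by rewrite invr_gt0.
    have s1 : 0 <= (L t - 1) ^+ 2 * e^-1 by rewrite mulr_ge0 ?sqr_ge0// ltW.
    have s2 : 0 <= (L t - 1 + e) ^+ 2 * e^-1 by rewrite mulr_ge0 ?sqr_ge0// ltW.
    (* Right side minus left side is [(L t - 1 + e) ^+ 2 / (2 * e)] where the test accepts, and
       [(L t - 1) ^+ 2 / (2 * e) + e / 2] where it rejects. *)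
    rewrite e1; case: AE => ->.
      have : (L t - 1 + e) ^+ 2 * e^-1 = (L t - 1) ^+ 2 * e^-1 + 2 * (L t - 1) + e.
        by field; rewrite gt_eqF.
      move: s2; lra.
    by move: s1; lra.
have eh : 0 <= e / 2 + (2 * e)^-1 by rewrite addr_ge0 ?divr_ge0 ?invr_ge0 ?mulr_ge0 ?(ltW e0).
have ei : 0 <= (2 * e)^-1 by rewrite invr_ge0 mulr_ge0// ltW.
have mL2 : measurable_fun [set: obs] (fun t => L t ^+ 2) by exact: measurable_funX.
move: ineq; rewrite null_ED//; last 2 first.
- exact: measurable_funM.
- by move=> t; rewrite mulr_ge0// invr_ge0 ltW.
rewrite null_E_cst// null_EZ//; last by rewrite invr_ge0 ltW.
rewrite EL mule1.
rewrite null_ED; first last.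
- by move=> t; rewrite addr_ge0// mulr_ge0// sqr_ge0.
- by apply: measurable_funD => //; exact: measurable_funM.
- by move=> t; rewrite addr_ge0// mulr_ge0.
- by apply: measurable_funD; [exact: mI|apply: measurable_funM => //; exact: mI].
rewrite null_ED; first last.
- by move=> t; rewrite mulr_ge0.
- by apply: measurable_funM => //; exact: mI.
- by move=> t.
- exact: mI.
rewrite null_ED//; last 2 first.
- exact: measurable_funM.
- by move=> t; rewrite mulr_ge0// sqr_ge0.
rewrite null_E_cst// null_EZ//; last by move=> t; exact: sqr_ge0.
move=> ineq.
have {}ineq : ((1 + e^-1)%:E <= null_E (\1_A : obs -> R) + M +
   (e / 2 + (2 * e)^-1 + (2 * e)^-1 * (1 + D))%:E)%E.
  rewrite [(1 + _)%:E]EFinD (le_trans ineq)//; apply: leeD; first exact: leeD.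
  rewrite [leRHS]EFinD; apply: leeD => //; rewrite [leRHS]EFinM.
  by apply: lee_wpmul2l; rewrite ?lee_fin.
(* [M] is not known to be finite here, so a finite constant is added to both sides instead of
   subtracting. *)
rewrite -(@leeD2rE _ (e / 2 + (2 * e)^-1 + (2 * e)^-1 * (1 + D))%:E)//.
apply: le_trans ineq; rewrite -EFinD lee_fin le_eqVlt; apply/orP; left; apply/eqP.
by field; rewrite gt_eqF.
Qed.

(** First kind: the rejection indicator is at most the sum of the [L_S / T], each [L_S] having mean
    1. Second kind: where the test accepts, [L_S < T], hence [L_S <= sqrt T * sqrt L_S]. *)
Lemma minimax_risk_scan k (C : pred (k.-tuple V)) psi (T : R) :
  `|psi| < 1 -> 0 < T -> (forall S, C S -> uniq S) ->
  (minimax_risk (R := R) C psi <= (#|[pred S | C S]|%:R / T +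
    Num.sqrt T * (2 * Num.sqrt (2 * Num.sqrt (1 - psi ^+ 2)) ^+ k.-1))%:E)%E.
Proof.
move=> psi1 T0 uC.
pose f (t : obs) : bool := [exists S : k.-tuple V, C S && (T <= path_lr psi S t)].
pose A := \big[setU/set0]_(S : k.-tuple V | C S) [set t : obs | T <= path_lr psi S t].
have fE : f @^-1` [set true] = A.
  rewrite /A -bigcup_seq_cond; apply/seteqP; split => t /=.
    by move=> /existsP[S /andP[CS TS]]; exists S => //=; rewrite mem_index_enum.
  by move=> [S /= /andP[_ CS] TS]; apply/existsP; exists S; rewrite CS.
have mA : measurable A.
  apply: bigsetU_measurable => S _; rewrite -[X in measurable X]setTI.
  rewrite (_ : [set t | _] = path_lr psi S @^-1` `[T, +oo[); last first.
    by apply/seteqP; split=> t /=; rewrite in_itv/= andbT.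
  exact: (measurable_path_lr psi S).
have mf : measurable_fun setT f.
  by apply: (measurable_fun_bool true); rewrite setTI fE.
apply: ge_ereal_inf; exists (worst_case_risk C psi f); first by exists f.
rewrite /worst_case_risk density_law_null_pdf EFinD; apply: leeD.
  pose s := [seq S <- index_enum (k.-tuple V) | C S].
  apply: (@le_trans _ _ (null_E (fun t => T^-1 * \sum_(S <- s) path_lr psi S t))).
    apply: le_null_E.
    - by rewrite fE; exact: measurable_indic.
    - by move=> t; rewrite indicE.
    - by apply: measurable_funM => //; apply: measurable_sum => S; exact: measurable_path_lr.
    - move=> t; rewrite indicE; case: (boolP (t \in _)); last first.
        move=> _; rewrite mulr_ge0 ?invr_ge0 ?(ltW T0)// sumr_ge0// => S _.
        exact: path_lr_ge0.
      move=> /set_mem /= /existsP[S /andP[CS TS]].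
      rewrite [leRHS]mulrC ler_pdivlMr// mul1r /s big_filter (bigD1 S)//=.
      rewrite (le_trans TS)// lerDl sumr_ge0// => S' _.
      exact: path_lr_ge0.
  rewrite null_EZ; last first.
  - by rewrite invr_ge0 ltW.
  - by move=> t; rewrite sumr_ge0// => S _; exact: path_lr_ge0.
  - by apply: measurable_sum => S; exact: measurable_path_lr.
  rewrite null_E_sum; last 2 first.
  - by move=> S; exact: measurable_path_lr.
  - by move=> S t; exact: path_lr_ge0.
  rewrite /s big_filter; under eq_bigr => S CS do rewrite null_E_path_lr ?uC//.
  by rewrite sumEFin sumr_const -EFinM lee_fin mulrC.
apply: bigmax_le => [|S CS].
  by rewrite lee_fin !mulr_ge0 ?exprn_ge0 ?sqrtr_ge0.
rewrite density_law_path_pdf ?uC//.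
have mB : measurable (f @^-1` [set false]) by exact: measurable_test.
have mq : measurable_fun [set: obs] (fun t => Num.sqrt (path_lr psi S t)).
  by apply: (measurableT_comp (@measurable_sqrtr R)); exact: measurable_path_lr.
apply: (@le_trans _ _ (null_E (fun t => Num.sqrt T * Num.sqrt (path_lr psi S t)))).
  apply: le_null_E.
  - by apply: measurable_funM; [exact: measurable_path_lr|exact: measurable_indic].
  - by move=> t; rewrite mulr_ge0 ?path_lr_ge0// indicE.
  - exact: measurable_funM.
  - move=> t; rewrite indicE; case: (boolP (t \in _)); last first.
      by move=> _; rewrite mulr0 mulr_ge0// sqrtr_ge0.
    move=> /set_mem /= /negbT; rewrite negb_exists => /forallP/(_ S).
    rewrite CS /= -ltNge => LT; rewrite mulr1.
    rewrite -[leLHS]sqr_sqrtr ?path_lr_ge0// expr2 ler_wpM2r ?sqrtr_ge0//.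
    by rewrite ler_sqrt// ltW.
rewrite null_EZ ?sqrtr_ge0// EFinM; apply: lee_wpmul2l.
  by rewrite lee_fin sqrtr_ge0.
by rewrite -[in leRHS](size_tuple S); apply: null_E_sqrt_path_lr => //; exact: uC.
Qed.

End risk.

(** * Risk bounds on the torus in the two regimes, and their limits *)

Section limits.
Context (R : realType).

Lemma cvge_bounds (u : nat -> \bar R) (l : R) :
  (forall e, 0 < e -> \forall m \near \oo, ((l - e)%:E <= u m /\ u m <= (l + e)%:E)%E) ->
  u m @[m --> \oo] --> l%:E.
Proof.
move=> H; apply/fine_cvgP; split.
  have := H 1 ltr01; apply: filterS => m [h1 h2].
  by rewrite fin_numE; apply/andP; split; apply/eqP => um; rewrite um in h1 h2.
apply/cvgrPdist_le => e e0; have := H e e0; apply: filterS => m [h1 h2] /=.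
have um : u m \is a fin_num.
  by rewrite fin_numE; apply/andP; split; apply/eqP => um; rewrite um in h1 h2.
move: h1 h2; rewrite -(fineK um) !lee_fin => h1 h2.
by rewrite ler_norml; apply/andP; split; lra.
Qed.

Lemma minimax_risk_small_psi d m k (psi e : R) : (2 < d)%N -> (0 < m)%N -> (k <= m)%N ->
  `|psi| < 128^-1 -> 0 < e -> e ^- 2 <= m%:R ->
  ((1 - e)%:E <= minimax_risk (R := R) (@self_avoiding_path _ (@torus_adj m d) k) psi)%E.
Proof.
move=> d3 m0 km psi1 e0 em.
have mR : 0 < m%:R :> R by rewrite ltr0n.
(* [b] is [16 * 128 ^- 2], which fits [16 * psi ^+ 2 <= b]; [l] satisfies [l * 64 = 2^-1], as the
   moment bound requires, and leaves room for [kernel_growth b <= 1 + l]. *)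
pose b : R := 1024^-1; pose l : R := 128^-1.
have l0 : 0 <= l by rewrite invr_ge0.
have growth : kernel_growth b <= 1 + l.
  rewrite /kernel_growth (_ : (1 - b)^-1 = 1024 / 1023); last by rewrite /b; field.
  by rewrite /l expr2; lra.
have growth0 : 0 <= kernel_growth b by exact: sqr_ge0.
have psi2 : 16 * psi ^+ 2 <= b.
  have : `|psi| ^+ 2 <= (128^-1) ^+ 2 by rewrite lerXn2r ?nnegrE ?invr_ge0// ltW.
  rewrite real_normK ?num_real// /b expr2 => h.
  have -> : 1024^-1 = 16 * (128^-1 * 128^-1) :> R by field.
  by rewrite ler_pM2l//.
have psi_lt1 : `|psi| < 1 by apply: lt_le_trans psi1 _; lra.
pose I : finType := (torus m d * coins m)%type.
pose S (p : I) := torus_path m0 k p.1 p.2.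
have I0 : (0 < #|I|)%N.
  apply/card_gt0P; exists ([ffun=> Ordinal m0], [ffun=> (ord0, ord0)]).
  by rewrite inE.
have b0 : 0 <= b by rewrite /b; lra.
have b2 : b <= 2^-1 by rewrite /b; lra.
have uS p : uniq (S p) by exact: torus_path_uniq.
apply: (@le_trans _ _ (1 - e / 2 - (2 * l / m%:R) / (2 * e))%:E).
  rewrite lee_fin.
  have h : 2 * l / m%:R <= e ^+ 2.
    rewrite ler_pdivrMr// [leRHS]mulrC; apply: (@le_trans _ _ (e ^- 2 * e ^+ 2)).
      by rewrite mulVf ?expf_neq0 ?gt_eqF// /l; lra.
    by rewrite ler_wpM2r// sqr_ge0.
  have : 2 * l / m%:R / (2 * e) <= e / 2.
    rewrite ler_pdivrMr ?mulr_gt0//; apply: le_trans h _.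
    by rewrite expr2; lra.
  lra.
apply: (@minimax_risk_second_moment R _ k _ psi I S) => //.
  by move=> p; exact: torus_path_self_avoiding.
apply: (@le_trans _ _ (\sum_(p : I) \sum_(p' : I)
    ((1 + l) ^+ #|[set v in S p | v \in S p']%SET|)%:E)%E).
  apply: lee_sum => p _; apply: lee_sum => p' _.
  apply: (le_trans (null_E_path_lrM b0 b2 psi2 (uS p) (uS p'))).
  by rewrite lee_fin lerXn2r ?nnegrE// addr_ge0.
under eq_bigr do rewrite sumEFin.
rewrite sumEFin lee_fin exchange_big/=.
apply: (@le_trans _ _ (\sum_(p' : I) #|I|%:R * (1 + 2 * l / m%:R))).
  apply: ler_sum => p' _; apply: path_meet_moment => //.
  by rewrite /l; lra.
by rewrite sumr_const -[leLHS]mulr_natl mulrA -expr2.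
Qed.

Lemma minimax_risk_large_psi d m k (psi C0 : R) :
  let th := expR (d.+1%:R / C0) in
  (0 < d)%N -> 0 < C0 -> (1 < m)%N -> C0 <= k%:R / ln m%:R ->
  `|psi| < 1 -> 1 - psi ^+ 2 <= (16 * d%:R * th) ^- 2 ->
  (minimax_risk (R := R) (@self_avoiding_path _ (@torus_adj m d) k) psi <=
   (m%:R^-1 + 2 * Num.sqrt th / (C0 * ln m%:R))%:E)%E.
Proof.
move=> th d0 C00 m1 kC psi1 psic.
have m0 : 0 < m%:R :> R by rewrite ltr0n ltnW.
have lnm0 : 0 < ln m%:R :> R by rewrite ln_gt0// ltr1n.
have th0 : 0 < th by exact: expR_gt0.
have dR : 0 < d%:R :> R by rewrite ltr0n.
have kC' : C0 * ln m%:R <= k%:R by rewrite -ler_pdivlMr.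
have kR : 0 < k%:R :> R by apply: lt_le_trans kC'; rewrite mulr_gt0.
have k0 : (0 < k)%N by rewrite -(ltr0n R).
(* [K] bounds the number of paths. The scan threshold [m * K] makes the error of the first kind at
   most [m ^- 1]. *)
pose K : R := m%:R ^+ d * (2 * d%:R) ^+ k.-1.
have K0 : 0 < K by rewrite mulr_gt0 ?exprn_gt0 ?mulr_gt0.
have T0 : 0 < m%:R * K by rewrite mulr_gt0.
apply: (le_trans (minimax_risk_scan psi1 T0 _)); first by move=> S /andP[].
rewrite lee_fin; apply: lerD.
  rewrite ler_pdivrMr// mulKf ?gt_eqF//.
  apply: (@le_trans _ _ (m ^ d * (2 * d) ^ k.-1)%N%:R).
    by rewrite ler_nat card_torus_paths.
  by rewrite natrM !natrX natrM.
set h := Num.sqrt (2 * _).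
have h2 : h ^+ 2 <= (8 * d%:R * th)^-1.
  rewrite sqr_sqrtr ?mulr_ge0 ?sqrtr_ge0//.
  have q0 : 0 < 16 * d%:R * th by rewrite !mulr_gt0.
  have : Num.sqrt (1 - psi ^+ 2) <= (16 * d%:R * th)^-1.
    have qi : 0 <= (16 * d%:R * th)^-1 by rewrite invr_ge0 ltW.
    by rewrite -(ger0_norm qi) -sqrtr_sqr; apply: ler_wsqrtr; rewrite exprVn.
  have -> : (8 * d%:R * th)^-1 = 2 * (16 * d%:R * th)^-1.
    by field; rewrite !gt_eqF.
  by lra.
(* [th] is chosen for this: [k >= C0 * ln m] converts the polynomial factor [m ^ d.+1] into an
   exponential in [k]. *)
have mth : m%:R ^+ d.+1 <= th ^+ k.
  rewrite /th -expRM_natl -[m%:R in leLHS]lnK ?posrE// -expRM_natl ler_expR.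
  by rewrite [leRHS]mulrCA ler_wpM2l// ler_pdivlMr// mulrC.
(* After squaring, the left side is [m ^ d.+1 * (2 * d * h ^ 2) ^ k.-1], at most [th ^ k * (4 * th)
   ^- k.-1 = th * 4 ^- k.-1]. *)
have main : Num.sqrt (m%:R * K) * h ^+ k.-1 <= Num.sqrt th / 2 ^+ k.-1.
  have h0 : 0 <= h by exact: sqrtr_ge0.
  rewrite -[h ^+ _]ger0_norm ?exprn_ge0// -sqrtr_sqr -sqrtrM ?(ltW T0)//.
  have -> : Num.sqrt th / 2 ^+ k.-1 = Num.sqrt (th * (4^-1) ^+ k.-1).
    rewrite sqrtrM ?(ltW th0)// (_ : 4^-1 = 2^-1 ^+ 2); last by rewrite expr2; field.
    by rewrite exprAC sqrtr_sqr ger0_norm ?exprVn// invr_ge0 exprn_ge0.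
  apply: ler_wsqrtr.
  have -> : m%:R * K * (h ^+ k.-1) ^+ 2 = m%:R ^+ d.+1 * (2 * d%:R * h ^+ 2) ^+ k.-1.
    by rewrite /K [m%:R ^+ d.+1]exprS [in RHS]exprMn exprAC !mulrA.
  apply: (@le_trans _ _ (th ^+ k * ((4 * th)^-1) ^+ k.-1)).
    have g0 : 0 <= 2 * d%:R * h ^+ 2 by rewrite mulr_ge0 ?sqr_ge0// mulr_ge0// ltW.
    apply: ler_pM; rewrite ?exprn_ge0 ?(ltW m0)//.
      rewrite lerXn2r ?nnegrE ?invr_ge0 ?mulr_ge0 ?(ltW th0)//.
      apply: (@le_trans _ _ (2 * d%:R * (8 * d%:R * th)^-1)).
        by rewrite ler_wpM2l// mulr_ge0// ltW.
      by rewrite le_eqVlt; apply/orP; left; apply/eqP; field; rewrite !gt_eqF.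
  rewrite -{1}(prednK k0) exprS -mulrA -exprMn.
  rewrite (_ : th * (4 * th)^-1 = 4^-1)//; first by field; rewrite gt_eqF.
rewrite mulrCA -[leRHS]mulrA ler_pM2l//; apply: (le_trans main).
rewrite ler_wpM2l ?sqrtr_ge0// lef_pV2 ?posrE ?exprn_gt0 ?mulr_gt0//.
(* The crude bound [k <= 2 ^ k.-1] suffices, as [k] is at least of order [ln m]. *)
apply: (le_trans kC'); rewrite -natrX ler_nat -{1}(prednK k0).
exact: ltn_expl.
Qed.

End limits.

Theorem corollary2 (R : realType) (d : nat) (C0 : R) :
  (3 <= d)%N -> 0 < C0 ->
  exists C1 C2 : R, [/\ 0 < C1, C1 <= C2, C2 < 1 &
    forall (psi : R) (k : nat -> nat),
      -1 < psi < 1 ->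
      (\forall m \near \oo,
         (k m <= m)%N /\ C0 <= (k m)%:R / ln (m%:R : R)) ->
      (`|psi| < C1 ->
         minimax_risk (@self_avoiding_path _ (@torus_adj m d) (k m)) psi
           @[m --> \oo] --> 1%E) /\
      (C2 < `|psi| ->
         minimax_risk (@self_avoiding_path _ (@torus_adj m d) (k m)) psi
           @[m --> \oo] --> 0%E)].
Proof.
move=> d3 C00.
pose th := expR (d.+1%:R / C0) : R.
have th1 : 1 <= th by rewrite -expR0 ler_expR divr_ge0// ltW.
have dR : 3 <= d%:R :> R by rewrite ler_nat.
have q1 : 16 <= 16 * d%:R * th by nra.
have q0 : 0 < 16 * d%:R * th by lra.
pose c := (16 * d%:R * th) ^- 2.
have c0 : 0 < c by rewrite invr_gt0 exprn_gt0.
have c1 : c <= 1 by rewrite invf_le1 ?exprn_gt0// exprn_ege1//; lra.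
(* If [|psi| > 1 - c / 2] then [1 - psi ^+ 2 = (1 - |psi|) * (1 + |psi|) < c], as the scan bound
   requires. *)
exists 128^-1, (1 - c / 2); split; [by []|lra|lra|].
move=> psi k psi1 hk.
have {}psi1 : `|psi| < 1 by rewrite ltr_norml.
split=> hpsi; apply: cvge_bounds => e e0.
  have e2 : \forall m \near \oo, e ^- 2 < m%:R by exact: nbhs_infty_gtr.
  near=> m.
  have [km _] : (k m <= m)%N /\ C0 <= (k m)%:R / ln (m%:R : R) by near: m.
  have em : e ^- 2 < m%:R by near: m.
  have m0 : (0 < m)%N.
    by rewrite -(ltr0n R); apply: lt_trans em; rewrite invr_gt0 exprn_gt0.
  split; first by apply: minimax_risk_small_psi => //; exact: ltW.
  by apply: le_trans (minimax_risk_le1 _ psi1) _; rewrite lee_fin lerDl ltW.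
(* For [m > M] the term in [1 / ln m] is at most [e / 2], and for [m > 2 / e] so is [m ^- 1]. *)
pose M := expR (4 * Num.sqrt th / (C0 * e)).
have hm1 : \forall m \near \oo, M < m%:R by exact: nbhs_infty_gtr.
have hm2 : \forall m \near \oo, 2 / e < m%:R by exact: nbhs_infty_gtr.
near=> m.
have [km kC] : (k m <= m)%N /\ C0 <= (k m)%:R / ln (m%:R : R) by near: m.
have em1 : M < m%:R by near: m.
have em2 : 2 / e < m%:R by near: m.
have s0 : 0 < Num.sqrt th by rewrite sqrtr_gt0; lra.
have M1 : 1 <= M.
  by rewrite -[leLHS]expR0 ler_expR divr_ge0 ?mulr_ge0 ?(ltW s0) ?(ltW e0) ?(ltW C00).
have m1 : (1 < m)%N by rewrite -(ltr1n R); exact: le_lt_trans em1.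
have mR : 0 < m%:R :> R by rewrite ltr0n ltnW.
split.
  rewrite sub0r; apply: le_trans (minimax_risk_ge0 _ _).
  by rewrite lee_fin oppr_le0 ltW.
have psic : 1 - psi ^+ 2 <= c.
  by rewrite -[psi ^+ 2]real_normK ?num_real//; nra.
apply: (le_trans (minimax_risk_large_psi (ltnW (ltnW d3)) C00 m1 kC psi1 psic)).
rewrite add0r lee_fin -/th.
have b1 : m%:R^-1 <= e / 2.
  rewrite -[e / 2]invrK lef_pV2 ?posrE ?invr_gt0 ?divr_gt0// invf_div.
  exact: ltW.
have lnm : 4 * Num.sqrt th / (C0 * e) < ln m%:R.
  by rewrite -ltr_expR lnK ?posrE.
have lnm0 : 0 < ln m%:R :> R by rewrite ln_gt0// ltr1n.
have b2 : 2 * Num.sqrt th / (C0 * ln m%:R) <= e / 2.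
  rewrite ler_pdivrMr ?mulr_gt0//.
  move: lnm; rewrite ltr_pdivrMr ?mulr_gt0//; lra.
lra.
Unshelve. all: by end_near.
Qed.
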